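(* Let $\mathfrak{g}$ be a finite dimensional $p$-step nilpotent Lie algebra over a field $k$ and let $M$ be a finite dimensional $q$-step nilpotent $\mathfrak{g}$-module. Let $r$ be any integer with $\max\{p,q\}\le r\le p+q$ and let $$0\to\mathfrak{n}\to\mathfrak{f}_{n,r}\xrightarrow{\pi}\mathfrak{g}\to 0$$ be a free $r$-step nilpotent extension of $\mathfrak{g}$. Regard $M$ as an $\mathfrak{f}_{n,r}$-module via $\pi$, and let $\pi^2:\mathrm{H}^2(\mathfrak{g},M)\to\mathrm{H}^2(\mathfrak{f}_{n,r},M)$ be the map induced by $\pi$. Then $$F_r\mathrm{H}^2(\mathfrak{g},M)=\mathrm{Ker}\big(\pi^2:\mathrm{H}^2(\mathfrak{g},M)\to\mathrm{H}^2(\mathfrak{f}_{n,r},M)\big).$$ Furthermore, there is an exact sequence $$0\to\mathrm{H}^1(\mathfrak{g},M)\to\mathrm{H}^1(\mathfrak{f}_{n,r},M)\to\mathrm{Hom}_{\mathfrak{g}}\Big(\frac{\mathfrak{n}}{[\mathfrak{n},\mathfrak{n}]},M\Big)\xrightarrow{d}F_r\mathrm{H}^2(\mathfrak{g},M)\to 0,$$ in which the first map is inflation along $\pi$, the second is restriction to $\mathfrak{n}$, and $d(f)=\overline{f\circ\varphi_r}$, where $\varphi_r$ is a $2$-cocycle of $\mathfrak{g}$ with values in $\mathfrak{n}/[\mathfrak{n},\mathfrak{n}]$ corresponding to the extension $$0\to\frac{\mathfrak{n}}{[\mathfrak{n},\mathfrak{n}]}\to\frac{\mathfrak{f}_{n,r}}{[\mathfrak{n},\mathfrak{n}]}\xrightarrow{\pi}\mathfrak{g}\to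 0.$$ If $M$ is a trivial $\mathfrak{g}$-module, then the map $d$ is an isomorphism.
   Context: All Lie algebras and modules named are finite dimensional over an arbitrary field $k$. The lower central series of $\mathfrak{g}$ is $\mathfrak{g}^1=\mathfrak{g}$, $\mathfrak{g}^{i+1}=[\mathfrak{g},\mathfrak{g}^i]$; $\mathfrak{g}$ is $p$-step nilpotent ($p\ge1$) if $\mathfrak{g}^p\neq0$ and $\mathfrak{g}^{p+1}=0$. For a $\mathfrak{g}$-module $M$ set $M_j=0$ for integers $j\le 0$ and $M_i=\{m\in M\mid xm\in M_{i-1}\text{ for all }x\in\mathfrak{g}\}$ for $i\ge1$. $M$ is $q$-step nilpotent ($q\ge 1$) if $M_{q-1}\ne M$ and $M_q=M$. Cohomology is computed by the Chevalley-Eilenberg complex $\mathrm{Hom}_k(\Lambda^{*}(\mathfrak{g}),M)$; $\overline{\omega}$ denotes the class of a cocycle $\omega$. For each $n$ and $r$, let $F_r\mathrm{Hom}_k(\Lambda^n(\mathfrak{g}),M)$ be the set of $f\in\mathrm{Hom}_k(\Lambda^n(\mathfrak{g}),M)$ such that $f(x_1\wedge\dots\wedge x_n)\in M_{r-i_1-\dots-i_n+1}$ whenever $x_1\in\mathfrak{g}^{i_1},\dots,x_n\in\mathfrak{g}^{i_n}$. For each $r$ these form a subcomplex, and $F_r\mathrm{H}^2(\mathfrak{g},M)\subset \mathrm{H}^2(\mathfrak{g},M)$ is the image of the degree-2 cohomology of this subcomplex, i.e. the set of classes represented by $2$-cocycles lying in $F_r\mathrm{Hom}_k(\Lambda^2(\mathfrak{g}),M)$.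 Let $\mathfrak{f}_n$ be the free Lie algebra over $k$ on $n$ generators; $\mathfrak{f}_{n,r}=\mathfrak{f}_n/\mathfrak{f}_n^{r+1}$ is the free $r$-step nilpotent Lie algebra on $n$ generators. Let $\mathfrak{g}$ be $p$-step nilpotent with $n=\dim_k\mathfrak{g}/[\mathfrak{g},\mathfrak{g}]$. A free $p$-step nilpotent extension of $\mathfrak{g}$ is a short exact sequence of Lie algebras $0\to\mathfrak{n}\to\mathfrak{f}_{n,p}\xrightarrow{\pi}\mathfrak{g}\to0$ with $\mathfrak{n}\subset[\mathfrak{f}_{n,p},\mathfrak{f}_{n,p}]$. For $r\ge p$, a free $r$-step nilpotent extension of $\mathfrak{g}$ is a short exact sequence $0\to\mathfrak{n}'\to\mathfrak{f}_{n,r}\xrightarrow{\pi'}\mathfrak{g}\to0$ where $\pi'$ is the composition of the canonical projection $\mathfrak{f}_{n,r}\to\mathfrak{f}_{n,p}$ with the map $\pi:\mathfrak{f}_{n,p}\to\mathfrak{g}$ of some free $p$-step nilpotent extension of $\mathfrak{g}$. The $\mathfrak{g}$-module structure on $\mathfrak{n}/[\mathfrak{n},\mathfrak{n}]$ is induced by the bracket of $\mathfrak{f}_{n,r}$ (lift an element of $\mathfrak{g}$ to $\mathfrak{f}_{n,r}$ and bracket). For an extension $0\to A\to\mathfrak{e}\xrightarrow{\pi}\mathfrak{g}\to0$ with $A$ abelian, a corresponding $2$-cocycle is one representing the class of $(x\wedge y)\mapsto[s(x),s(y)]-s([x,y])$, where $s:\mathfrak{g}\to\mathfrak{e}$ is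 any linear map with $\pi\circ s=\mathrm{Id}$. *)

(* Defs.v *)
From HB Require Import structures.
From mathcomp Require Import all_boot all_order all_algebra.
From mathcomp Require Import boolp functions.
Import GRing.Theory.

Set Implicit Arguments.
Unset Strict Implicit.
Unset Printing Implicit Defensive.

Local Open Scope ring_scope.
Local Open Scope quotient_scope.

(** * Linear algebra without a dimension hypothesis *)

(* Mathcomp's [submodClosed] does not record closure under opposite, which   *)
(* [Quotient.quot] needs.                                                    *)
Section SubmodZmod.
Variables (k : fieldType) (V : lmodType k) (I : submodClosed V).
Definition submod_pred : {pred V} := fun x => x \in I.
Fact submod_pred_closed : submod_closed submod_pred.
Proof.
split=> [|a x y xI yI]; rewrite unfold_in ?rpred0 //.
by rewrite rpredD ?rpredZ.
Qed.
HB.instance Definition _ :=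
  GRing.isSubmodClosed.Build k V submod_pred submod_pred_closed.
Lemma submodN x : (- x \in I) = (x \in I).
Proof. exact: (@rpredN _ submod_pred). Qed.
End SubmodZmod.

Section Submodules.
Variables (k : fieldType) (V W : lmodType k).

Definition span (A : {pred V}) : {pred V} := fun x =>
  `[< exists2 s : seq (k * V),
        all (fun u => u.2 \in A) s & x = \sum_(u <- s) u.1 *: u.2 >].

Lemma span_submod A : submod_closed (span A).
Proof.
split; first by apply/asboolP; exists [::]; rewrite ?big_nil.
move=> a x y /asboolP[s sA ->] /asboolP[t tA ->]; apply/asboolP.
exists ([seq (a * u.1, u.2) | u <- s] ++ t).
  by rewrite all_cat tA all_map andbT.
rewrite big_cat big_map scaler_sumr; congr (_ + _).
by apply: eq_bigr => u _; rewrite scalerA.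
Qed.
HB.instance Definition _ A :=
  GRing.isSubmodClosed.Build k V (span A) (span_submod A).

Lemma mem_span (A : {pred V}) x : x \in A -> x \in span A.
Proof.
by move=> Ax; apply/asboolP; exists [:: (1, x)]; rewrite /= ?Ax ?big_seq1 ?scale1r.
Qed.

Lemma span_min (A : {pred V}) (S : submodClosed V) :
  {subset A <= S} -> {subset span A <= S}.
Proof.
move=> AS x /asboolP[s sA ->]; rewrite big_seq; apply: rpred_sum => u us.
by apply/rpredZ/AS; move/allP: sA; apply.
Qed.

Definition lkernel (f : V -> W) : {pred V} := fun x => f x == 0.

Lemma mem_lkernel (f : V -> W) x : (x \in lkernel f) = (f x == 0).
Proof. by []. Qed.

Lemma lkernel_submod (f : {linear V -> W}) : submod_closed (lkernel f).
Proof.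
split=> [|a x y]; rewrite !mem_lkernel ?linear0 //.
by move=> /eqP fx /eqP fy; rewrite linearP fx fy scaler0 addr0.
Qed.
HB.instance Definition _ (f : {linear V -> W}) :=
  GRing.isSubmodClosed.Build k V (lkernel f) (lkernel_submod f).

End Submodules.

Definition subm (k : fieldType) (V : lmodType k) (S : submodClosed V) :=
  {x : V | x \in S}.

Section SubmoduleType.
Variables (k : fieldType) (V : lmodType k) (S : submodClosed V).
HB.instance Definition _ := SubChoice.on (subm S).
HB.instance Definition _ := [SubChoice_isSubLmodule of subm S by <:].
Definition subm_in (x : V) (xS : x \in S) : subm S := exist _ x xS.
Lemma val_comb a (u v : subm S) : val (a *: u + v) = a *: val u + val v.
Proof. by rewrite linearP. Qed.
End SubmoduleType.

Definition lquot (k : fieldType) (V : lmodType k) (I : submodClosed V) :=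
  Quotient.quot (submod_pred I).

Section QuotientModule.
Variables (k : fieldType) (V : lmodType k) (I : submodClosed V).
HB.instance Definition _ := EqQuotient.on (lquot I).
HB.instance Definition _ := GRing.Zmodule.on (lquot I).

Definition lqpi (x : V) : lquot I := \pi_(lquot I) x.

Lemma lqpi_eq x y : (lqpi x == lqpi y) = (x - y \in I).
Proof. exact/esym/(@Quotient.idealrBE _ (submod_pred I)). Qed.

Lemma lqpiP x y : lqpi x = lqpi y <-> x - y \in I.
Proof. by rewrite -lqpi_eq; split=> /eqP. Qed.

Lemma lqpi_eq0 x : (lqpi x = 0) <-> (x \in I).
Proof.
have -> : 0 = lqpi 0 by rewrite /lqpi !piE.
by rewrite lqpiP subr0.
Qed.

Lemma lqpiK (x : lquot I) : lqpi (repr x) = x.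
Proof. exact: reprK. Qed.

Lemma lqpiD x y : lqpi (x + y) = lqpi x + lqpi y.
Proof. by rewrite /lqpi !piE. Qed.

Lemma repr_lqpi x : repr (lqpi x) - x \in I.
Proof. by rewrite -lqpi_eq lqpiK. Qed.

Definition lqscale (a : k) (x : lquot I) : lquot I := lqpi (a *: repr x).

Lemma lqscale_pi a x : lqscale a (lqpi x) = lqpi (a *: x).
Proof. by apply/lqpiP; rewrite -scalerBr rpredZ ?repr_lqpi. Qed.

Fact lqscaleA a b x : lqscale a (lqscale b x) = lqscale (a * b) x.
Proof. by rewrite -[x]lqpiK !lqscale_pi scalerA. Qed.
Fact lqscale1 : left_id 1 lqscale.
Proof. by move=> x; rewrite -[x]lqpiK lqscale_pi scale1r. Qed.
Fact lqscaleDr : right_distributive lqscale +%R.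
Proof.
move=> a x y; rewrite -[x]lqpiK -[y]lqpiK.
by rewrite -lqpiD !lqscale_pi scalerDr lqpiD.
Qed.
Fact lqscaleDl x : {morph lqscale^~ x : a b / a + b}.
Proof. by move=> a b; rewrite -[x]lqpiK !lqscale_pi scalerDl lqpiD. Qed.

HB.instance Definition _ := GRing.Zmodule_isLmodule.Build k (lquot I)
  lqscaleA lqscale1 lqscaleDr lqscaleDl.

Lemma lqpi_linear : linear lqpi.
Proof. by move=> a x y; rewrite lqpiD -lqscale_pi. Qed.
HB.instance Definition _ :=
  GRing.isLinear.Build k V (lquot I) *:%R lqpi lqpi_linear.

End QuotientModule.

Arguments lqpi {k V} I x.

Definition has_dim (k : fieldType) (V : lmodType k) (n : nat) : Prop :=
  exists f : {linear V -> 'rV[k]_n}, bijective f.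

Definition surjective (A B : Type) (f : A -> B) : Prop :=
  forall y, exists x, f x = y.

Definition exact_at (A B : Type) (C : zmodType) (f : A -> B) (h : B -> C) :
  Prop := forall y, h y = 0 <-> exists x, f x = y.

(** * Lie algebras *)

HB.mixin Record Lmodule_isLie (k : fieldType) L of GRing.Lmodule k L := {
  lbr : L -> L -> L;
  lbr_linearl : forall y, linear (lbr^~ y);
  lbr_linearr : forall x, linear (lbr x);
  lbrxx : forall x, lbr x x = 0;
  lbr_jacobi : forall x y z,
    lbr x (lbr y z) + lbr y (lbr z x) + lbr z (lbr x y) = 0
}.

#[short(type="lieType")]
HB.structure Definition Lie (k : fieldType) :=
  {L of Lmodule_isLie k L & GRing.Lmodule k L}.

#[short(type="finLieType")]
HB.structure Definition FinLie (k : fieldType) :=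
  {L of Lmodule_isLie k L & Vector k L}.

Notation "[ 'lie' x , y ]" := (lbr x y)
  (at level 0, x, y at level 99, format "[ 'lie'  x ,  y ]") : ring_scope.

HB.mixin Record isLieMorphism (k : fieldType) (L1 L2 : lieType k)
    (f : L1 -> L2) := { lie_morph : {morph f : x y / [lie x, y]} }.

HB.structure Definition LieMorphism (k : fieldType) (L1 L2 : lieType k) :=
  {f of isLieMorphism k L1 L2 f & @GRing.Linear k L1 L2 *:%R f}.

Notation "{ 'lie' L1 -> L2 }" := (LieMorphism.type L1 L2)
  (at level 0, L1 at level 98, L2 at level 99) : type_scope.

Section LieTheory.
Variables (k : fieldType) (L : lieType k).
Implicit Types (x y z : L).

Lemma lbrDl x y z : [lie x + y, z] = [lie x, z] + [lie y, z].
Proof. by have := lbr_linearl z 1 x y; rewrite !scale1r. Qed.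
Lemma lbrDr x y z : [lie x, y + z] = [lie x, y] + [lie x, z].
Proof. by have := lbr_linearr x 1 y z; rewrite !scale1r. Qed.
Lemma lbr0l y : [lie 0, y] = 0.
Proof. by apply: (addrI [lie 0, y]); rewrite -lbrDl !addr0. Qed.
Lemma lbr0r x : [lie x, 0] = 0.
Proof. by apply: (addrI [lie x, 0]); rewrite -lbrDr !addr0. Qed.
Lemma lbrZl a x y : [lie a *: x, y] = a *: [lie x, y].
Proof. by have := lbr_linearl y a x 0; rewrite !addr0 lbr0l addr0. Qed.
Lemma lbrZr a x y : [lie x, a *: y] = a *: [lie x, y].
Proof. by have := lbr_linearr x a y 0; rewrite !addr0 lbr0r addr0. Qed.
Lemma lbrNl x y : [lie - x, y] = - [lie x, y].
Proof. by rewrite -scaleN1r lbrZl scaleN1r. Qed.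
Lemma lbrNr x y : [lie x, - y] = - [lie x, y].
Proof. by rewrite -scaleN1r lbrZr scaleN1r. Qed.
Lemma lbrBl x y z : [lie x - y, z] = [lie x, z] - [lie y, z].
Proof. by rewrite lbrDl lbrNl. Qed.
Lemma lbrBr x y z : [lie x, y - z] = [lie x, y] - [lie x, z].
Proof. by rewrite lbrDr lbrNr. Qed.
Lemma lbrC x y : [lie x, y] = - [lie y, x].
Proof.
have := lbrxx (x + y); rewrite lbrDl !lbrDr !lbrxx add0r addr0.
by move/eqP; rewrite addr_eq0 => /eqP.
Qed.
Lemma lbr_der x y z :
  [lie x, [lie y, z]] = [lie [lie x, y], z] + [lie y, [lie x, z]].
Proof.
have := lbr_jacobi x y z; rewrite [[lie z, [lie x, y]]]lbrC.
rewrite [[lie z, x]]lbrC lbrNr => /eqP; rewrite -addrA addr_eq0 => /eqP ->.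
by rewrite opprD !opprK addrC.
Qed.

End LieTheory.

HB.mixin Record isIdealClosed (k : fieldType) (L : lieType k)
    (S : L -> bool) := {
  ideal_lbr : forall x y, y \in S -> [lie x, y] \in S
}.

#[short(type="lieIdeal")]
HB.structure Definition LieIdeal (k : fieldType) (L : lieType k) :=
  {S of isIdealClosed k L S & @GRing.SubmodClosed k L S}.

Section Ideals.
Variables (k : fieldType) (L : lieType k).

Definition lie_prod (A B : {pred L}) : {pred L} :=
  span (fun z => `[< exists x y, [/\ x \in A, y \in B & z = [lie x, y]] >]).
HB.instance Definition _ A B := GRing.SubmodClosed.on (lie_prod A B).

Lemma mem_lie_prod (A B : {pred L}) x y :
  x \in A -> y \in B -> [lie x, y] \in lie_prod A B.
Proof. by move=> xA yB; apply: mem_span; apply/asboolP; exists x, y. Qed.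

Lemma lie_prod_ideal (A B : lieIdeal L) x y :
  y \in lie_prod A B -> [lie x, y] \in lie_prod A B.
Proof.
move=> /asboolP[s sAB ->].
have lin0 : [lie x, \sum_(u <- s) u.1 *: u.2] = \sum_(u <- s) u.1 *: [lie x, u.2].
  elim: s {sAB} => [|u s IH]; first by rewrite !big_nil lbr0r.
  by rewrite !big_cons lbrDr lbrZr IH.
rewrite {}lin0 big_seq; apply: rpred_sum => u us; apply: rpredZ.
move/allP: sAB => /(_ u us) /asboolP[a [b [aA bB ->]]].
by rewrite lbr_der rpredD // mem_lie_prod // ideal_lbr.
Qed.
HB.instance Definition _ (A B : lieIdeal L) :=
  isIdealClosed.Build k L (lie_prod A B) (@lie_prod_ideal A B).

(* [lcs i] is the term of index i of the lower central series, for i >= 1; *)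
(* the value at 0 is a dummy.                                              *)
Fixpoint lcs (i : nat) : {pred L} :=
  match i with
  | j.+1 => if j is 0 then predT else lie_prod predT (lcs j)
  | 0 => predT
  end.

Lemma lcs_submod i : submod_closed (lcs i).
Proof. by case: i => [|[|i]] //=; apply: span_submod. Qed.

Lemma lcs_ideal i x y : y \in lcs i -> [lie x, y] \in lcs i.
Proof.
elim: i x y => [|[|i] IH] x y //.
move=> /asboolP[s sAB ->].
have lin0 : [lie x, \sum_(u <- s) u.1 *: u.2] = \sum_(u <- s) u.1 *: [lie x, u.2].
  elim: s {sAB} => [|u s IHs]; first by rewrite !big_nil lbr0r.
  by rewrite !big_cons lbrDr lbrZr IHs.
have [_ cl] := lcs_submod i.+2.
rewrite {}lin0 big_seq; apply: (@rpred_sum _ (lie_prod predT (lcs i.+1))).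
move=> u us; apply: rpredZ.
move/allP: sAB => /(_ u us) /asboolP[a [b [aA bB ->]]].
by rewrite lbr_der rpredD // mem_lie_prod // IH.
Qed.

HB.instance Definition _ i :=
  GRing.isSubmodClosed.Build k L (lcs i) (lcs_submod i).
HB.instance Definition _ i :=
  isIdealClosed.Build k L (lcs i) (@lcs_ideal i).

Definition nilpotent_step (p : nat) : Prop :=
  [/\ (0 < p)%N, ~ (lcs p =i pred1 0) & lcs p.+1 =i pred1 0].

End Ideals.

Arguments lcs {k} L i.
Arguments nilpotent_step {k} L p.

Section KernelIdeal.
Variables (k : fieldType) (L1 L2 : lieType k) (f : {lie L1 -> L2}).
Lemma lkernel_ideal x y : y \in lkernel f -> [lie x, y] \in lkernel f.
Proof. by rewrite !mem_lkernel lie_morph => /eqP ->; rewrite lbr0r. Qed.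
HB.instance Definition _ :=
  isIdealClosed.Build k L1 (lkernel f) lkernel_ideal.
End KernelIdeal.

Definition liequot (k : fieldType) (L : lieType k) (I : lieIdeal L) := lquot I.

Section LieQuotient.
Variables (k : fieldType) (L : lieType k) (I : lieIdeal L).
HB.instance Definition _ := EqQuotient.on (liequot I).
HB.instance Definition _ := GRing.Lmodule.on (liequot I).

Definition lieqpi (x : L) : liequot I := lqpi I x.
HB.instance Definition _ :=
  GRing.isLinear.Build k L (liequot I) *:%R lieqpi (lqpi_linear I).

Lemma lieqpiK (x : liequot I) : lieqpi (repr x) = x.
Proof. exact: reprK. Qed.

Definition liequot_br (x y : liequot I) := lieqpi [lie repr x, repr y].

Lemma liequot_br_pi x y : liequot_br (lieqpi x) (lieqpi y) = lieqpi [lie x, y].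
Proof.
apply/lqpiP; set x' := repr _; set y' := repr _.
have -> : [lie x', y'] - [lie x, y] = [lie x' - x, y'] + [lie x, y' - y].
  by rewrite lbrBl lbrBr addrA subrK.
rewrite rpredD //; first by rewrite lbrC submodN ideal_lbr ?repr_lqpi.
by rewrite ideal_lbr ?repr_lqpi.
Qed.

Fact liequot_linearl y : linear (liequot_br^~ y).
Proof.
move=> a u v; rewrite -[u]lieqpiK -[v]lieqpiK -[y]lieqpiK -linearP.
by rewrite !liequot_br_pi -linearP lbr_linearl.
Qed.
Fact liequot_linearr x : linear (liequot_br x).
Proof.
move=> a u v; rewrite -[u]lieqpiK -[v]lieqpiK -[x]lieqpiK -linearP.
by rewrite !liequot_br_pi -linearP lbr_linearr.
Qed.
Fact liequot_brxx x : liequot_br x x = 0.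
Proof. by rewrite -[x]lieqpiK liequot_br_pi lbrxx linear0. Qed.
Fact liequot_jacobi x y z :
  liequot_br x (liequot_br y z) + liequot_br y (liequot_br z x)
  + liequot_br z (liequot_br x y) = 0.
Proof.
rewrite -[x]lieqpiK -[y]lieqpiK -[z]lieqpiK !liequot_br_pi -!linearD.
by rewrite lbr_jacobi linear0.
Qed.
HB.instance Definition _ := Lmodule_isLie.Build k (liequot I)
  liequot_linearl liequot_linearr liequot_brxx liequot_jacobi.

Lemma lieqpi_morph : {morph lieqpi : x y / [lie x, y]}.
Proof. by move=> x y; rewrite -liequot_br_pi. Qed.
HB.instance Definition _ := isLieMorphism.Build k L (liequot I) lieqpi lieqpi_morph.

End LieQuotient.

Arguments lieqpi {k L} I x.

(** * Free Lie algebras *)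

(* Formal Lie expressions in n variables, modulo the smallest congruence     *)
(* that makes the Lie algebra axioms hold.                                   *)
Inductive lterm (k : fieldType) (n : nat) : Type :=
| LVar of 'I_n
| LZero
| LAdd of lterm k n & lterm k n
| LScale of k & lterm k n
| LBr of lterm k n & lterm k n.

Arguments LVar {k n} i.
Arguments LZero {k n}.

HB.instance Definition _ k n := gen_eqMixin (lterm k n).
HB.instance Definition _ k n := gen_choiceMixin (lterm k n).

Section FreeLie.
Variables (k : fieldType) (n : nat).
Local Notation T := (lterm k n).

Inductive lcong : T -> T -> Prop :=
| lc_refl t : lcong t t
| lc_sym t u : lcong t u -> lcong u t
| lc_trans t u v : lcong t u -> lcong u v -> lcong t v
| lc_add t t' u u' :
    lcong t t' -> lcong u u' -> lcong (LAdd t u) (LAdd t' u')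
| lc_scale a t t' : lcong t t' -> lcong (LScale a t) (LScale a t')
| lc_br t t' u u' :
    lcong t t' -> lcong u u' -> lcong (LBr t u) (LBr t' u')
| lc_addA t u v : lcong (LAdd t (LAdd u v)) (LAdd (LAdd t u) v)
| lc_addC t u : lcong (LAdd t u) (LAdd u t)
| lc_add0 t : lcong (LAdd LZero t) t
| lc_addN t : lcong (LAdd (LScale (-1) t) t) LZero
| lc_scaleA a b t : lcong (LScale a (LScale b t)) (LScale (a * b) t)
| lc_scale1 t : lcong (LScale 1 t) t
| lc_scaleDr a t u :
    lcong (LScale a (LAdd t u)) (LAdd (LScale a t) (LScale a u))
| lc_scaleDl a b t :
    lcong (LScale (a + b) t) (LAdd (LScale a t) (LScale b t))
| lc_brl a t u v :
    lcong (LBr (LAdd (LScale a t) u) v) (LAdd (LScale a (LBr t v)) (LBr u v))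
| lc_brr a t u v :
    lcong (LBr v (LAdd (LScale a t) u)) (LAdd (LScale a (LBr v t)) (LBr v u))
| lc_brxx t : lcong (LBr t t) LZero
| lc_jacobi t u v :
    lcong (LAdd (LAdd (LBr t (LBr u v)) (LBr u (LBr v t))) (LBr v (LBr t u)))
          LZero.

Definition lcongb : rel T := fun t u => `[< lcong t u >].

Lemma lcongb_equiv : equiv_class_of lcongb.
Proof.
split=> [t|t u|u t v]; first by apply/asboolP/lc_refl.
  by apply/asboolP/asboolP; apply: lc_sym.
by move=> /asboolP tu /asboolP uv; apply/asboolP/(lc_trans tu uv).
Qed.
Canonical lcongb_equivRel := EquivRelPack lcongb_equiv.
Canonical lcongb_encModRel := defaultEncModRel lcongb.

Definition freelie := {eq_quot lcongb}.
HB.instance Definition _ : EqQuotient T lcongb freelie := EqQuotient.on freelie.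
HB.instance Definition _ := Choice.on freelie.

Definition flpi (t : T) : freelie := \pi_freelie t.

Lemma flpiP t u : flpi t = flpi u <-> lcong t u.
Proof.
split=> [/eqP|h]; first by rewrite /flpi piE => /asboolP.
by apply/eqP; rewrite /flpi piE; apply/asboolP.
Qed.

Lemma flpiK x : flpi (repr x) = x. Proof. exact: reprK. Qed.

Lemma repr_flpi t : lcong (repr (flpi t)) t.
Proof. by apply/flpiP; rewrite flpiK. Qed.

Definition fl_add (x y : freelie) := flpi (LAdd (repr x) (repr y)).
Definition fl_scale a (x : freelie) := flpi (LScale a (repr x)).
Definition fl_br (x y : freelie) := flpi (LBr (repr x) (repr y)).
Definition fl_opp (x : freelie) := fl_scale (-1) x.
Definition fl_zero := flpi LZero.

Lemma fl_add_pi t u : fl_add (flpi t) (flpi u) = flpi (LAdd t u).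
Proof. by apply/flpiP/lc_add; apply: repr_flpi. Qed.
Lemma fl_scale_pi a t : fl_scale a (flpi t) = flpi (LScale a t).
Proof. by apply/flpiP/lc_scale; apply: repr_flpi. Qed.
Lemma fl_br_pi t u : fl_br (flpi t) (flpi u) = flpi (LBr t u).
Proof. by apply/flpiP/lc_br; apply: repr_flpi. Qed.
Let piE' := (fl_add_pi, fl_scale_pi, fl_br_pi).

Fact fl_addA : associative fl_add.
Proof.
move=> x y z; rewrite -[x]flpiK -[y]flpiK -[z]flpiK !piE'.
exact/flpiP/lc_addA.
Qed.
Fact fl_addC : commutative fl_add.
Proof. by move=> x y; rewrite -[x]flpiK -[y]flpiK !piE'; apply/flpiP/lc_addC. Qed.
Fact fl_add0 : left_id fl_zero fl_add.
Proof. by move=> x; rewrite -[x]flpiK !piE'; apply/flpiP/lc_add0. Qed.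
Fact fl_addN : left_inverse fl_zero fl_opp fl_add.
Proof. by move=> x; rewrite -[x]flpiK /fl_opp !piE'; apply/flpiP/lc_addN. Qed.
HB.instance Definition _ :=
  GRing.isZmodule.Build freelie fl_addA fl_addC fl_add0 fl_addN.

Fact fl_scaleA a b x : fl_scale a (fl_scale b x) = fl_scale (a * b) x.
Proof. by rewrite -[x]flpiK !piE'; apply/flpiP/lc_scaleA. Qed.
Fact fl_scale1 : left_id 1 fl_scale.
Proof. by move=> x; rewrite -[x]flpiK !piE'; apply/flpiP/lc_scale1. Qed.
Fact fl_scaleDr : right_distributive fl_scale +%R.
Proof.
move=> a x y; rewrite -[x]flpiK -[y]flpiK /GRing.add /= !piE'.
exact/flpiP/lc_scaleDr.
Qed.
Fact fl_scaleDl x : {morph fl_scale^~ x : a b / a + b}.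
Proof.
move=> a b; rewrite -[x]flpiK !piE' [RHS]fl_add_pi.
exact/flpiP/lc_scaleDl.
Qed.
HB.instance Definition _ := GRing.Zmodule_isLmodule.Build k freelie
  fl_scaleA fl_scale1 fl_scaleDr fl_scaleDl.

Lemma flpiD t u : flpi (LAdd t u) = flpi t + flpi u.
Proof. by rewrite -fl_add_pi. Qed.
Lemma flpiZ a t : flpi (LScale a t) = a *: flpi t.
Proof. by rewrite -fl_scale_pi. Qed.

Fact fl_brl y : linear (fl_br^~ y).
Proof.
move=> a u v; rewrite -[u]flpiK -[v]flpiK -[y]flpiK -flpiZ -flpiD.
by rewrite !fl_br_pi -flpiZ -flpiD; apply/flpiP/lc_brl.
Qed.
Fact fl_brr x : linear (fl_br x).
Proof.
move=> a u v; rewrite -[u]flpiK -[v]flpiK -[x]flpiK -flpiZ -flpiD.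
by rewrite !fl_br_pi -flpiZ -flpiD; apply/flpiP/lc_brr.
Qed.
Fact fl_brxx x : fl_br x x = 0.
Proof. by rewrite -[x]flpiK fl_br_pi; apply/flpiP/lc_brxx. Qed.
Fact fl_jacobi x y z :
  fl_br x (fl_br y z) + fl_br y (fl_br z x) + fl_br z (fl_br x y) = 0.
Proof.
rewrite -[x]flpiK -[y]flpiK -[z]flpiK !fl_br_pi -!flpiD.
exact/flpiP/lc_jacobi.
Qed.
HB.instance Definition _ :=
  Lmodule_isLie.Build k freelie fl_brl fl_brr fl_brxx fl_jacobi.

Definition flgen (i : 'I_n) : freelie := flpi (LVar i).

End FreeLie.

Section FreeLieUniversal.
Variables (k : fieldType) (n : nat) (L : lieType k) (v : 'I_n -> L).

Fixpoint leval (t : lterm k n) : L :=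
  match t with
  | LVar i => v i
  | LZero => 0
  | LAdd t u => leval t + leval u
  | LScale a t => a *: leval t
  | LBr t u => [lie leval t, leval u]
  end.

Lemma leval_cong t u : lcong t u -> leval t = leval u.
Proof.
elim=> //=.
- by move=> {}t {}u w _ -> _ ->.
- by move=> {}t t' {}u u' _ -> _ ->.
- by move=> a {}t t' _ ->.
- by move=> {}t t' {}u u' _ -> _ ->.
- by move=> *; rewrite addrA.
- by move=> *; rewrite addrC.
- by move=> *; rewrite add0r.
- by move=> *; rewrite scaleN1r addNr.
- by move=> *; rewrite scalerA.
- by move=> *; rewrite scale1r.
- by move=> *; rewrite scalerDr.
- by move=> *; rewrite scalerDl.
- by move=> *; rewrite lbrDl lbrZl.
- by move=> *; rewrite lbrDr lbrZr.
- by move=> *; rewrite lbrxx.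
- by move=> *; rewrite lbr_jacobi.
Qed.

Definition fl_lift (x : freelie k n) : L := leval (repr x).

Lemma fl_lift_pi t : fl_lift (flpi t) = leval t.
Proof. exact/leval_cong/repr_flpi. Qed.

Lemma fl_lift_linear : linear fl_lift.
Proof.
move=> a x y; rewrite -[x]flpiK -[y]flpiK -flpiZ -flpiD.
by rewrite !fl_lift_pi.
Qed.
HB.instance Definition _ :=
  GRing.isLinear.Build k (freelie k n) L *:%R fl_lift fl_lift_linear.

Lemma fl_lift_lie : {morph fl_lift : x y / [lie x, y]}.
Proof.
move=> x y; rewrite -[x]flpiK -[y]flpiK.
by rewrite [[lie _, _]]fl_br_pi !fl_lift_pi.
Qed.
HB.instance Definition _ :=
  isLieMorphism.Build k (freelie k n) L fl_lift fl_lift_lie.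

Lemma fl_lift_gen i : fl_lift (flgen k i) = v i.
Proof. exact: fl_lift_pi. Qed.

Lemma fl_lift_uniq (f : {lie freelie k n -> L}) :
  (forall i, f (flgen k i) = v i) -> f =1 fl_lift.
Proof.
move=> fv x; rewrite -[x]flpiK fl_lift_pi; elim: (repr x) => /=.
- exact: fv.
- exact: linear0.
- by move=> t IHt u IHu; rewrite flpiD linearD /= IHt IHu.
- by move=> a t IHt; rewrite flpiZ linearZ /= IHt.
- by move=> t IHt u IHu; rewrite -fl_br_pi (lie_morph (s := f)) IHt IHu.
Qed.

End FreeLieUniversal.

(** * Free nilpotent Lie algebras and free nilpotent extensions *)

Definition freenil (k : fieldType) (n r : nat) : Type :=
  liequot (lcs (freelie k n) r.+1).
HB.instance Definition _ k n r := Lie.on (freenil k n r).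

Definition freenil_pi k n r : {lie freelie k n -> freenil k n r} :=
  lieqpi (lcs (freelie k n) r.+1).

(* The canonical projection; only meaningful for p <= r. *)
Definition freenil_proj k n r p (x : freenil k n r) : freenil k n p :=
  freenil_pi k n p (repr x).

Lemma lcs_subset (k : fieldType) (L : lieType k) i j :
  (i <= j)%N -> {subset lcs L j <= lcs L i}.
Proof.
elim: j => [|j IH] in i *; first by case: i.
rewrite leq_eqVlt => /orP[/eqP -> //|]; rewrite ltnS => /IH ji x jx; apply: ji.
case: j jx {IH} => //= j; apply: (@span_min _ _ _ (lcs L j.+1)).
by move=> _ /asboolP[a [b [_ bB ->]]]; apply: ideal_lbr.
Qed.

Lemma freenil_proj_pi k n r p x : (p <= r)%N ->
  freenil_proj p (freenil_pi k n r x) = freenil_pi k n p x.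
Proof.
move=> pr; apply/lqpiP; apply: (@lcs_subset _ _ p.+1 r.+1) => //.
exact: repr_lqpi.
Qed.

Arguments freenil_proj {k n r} p x.

Section FreeExtensions.
Variables (k : fieldType) (n : nat) (g : lieType k).

(* The ideal n of the extension is the kernel of the surjection. *)
Definition free_extension p (pi : {lie freenil k n p -> g}) : Prop :=
  surjective pi /\ {subset lkernel pi <= lcs (freenil k n p) 2}.

Definition free_nilpotent_extension p r (pi' : {lie freenil k n r -> g}) :
    Prop :=
  exists2 pi : {lie freenil k n p -> g},
    free_extension pi & pi' =1 pi \o freenil_proj p.

End FreeExtensions.

(** * Modules *)

Record lie_action (k : fieldType) (g : lieType k) (M : lmodType k) :=
  LieAction {
    act :> g -> M -> M;
    act_linearl : forall m, linear (act^~ m);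
    act_linearr : forall x, linear (act x);
    act_lie : forall x y m,
      act [lie x, y] m = act x (act y m) - act y (act x m)
  }.

Section Modules.
Variables (k : fieldType) (g : lieType k) (M : lmodType k).
Variable rho : lie_action g M.

Definition trivial_action : Prop := forall x m, rho x m = 0.

Lemma actDr x m m' : rho x (m + m') = rho x m + rho x m'.
Proof. by have := act_linearr rho x 1 m m'; rewrite !scale1r. Qed.
Lemma act0r x : rho x 0 = 0.
Proof. by apply: (addrI (rho x 0)); rewrite -actDr !addr0. Qed.
Lemma actZr a x m : rho x (a *: m) = a *: rho x m.
Proof. by have := act_linearr rho x a m 0; rewrite !addr0 act0r addr0. Qed.
Lemma actNr x m : rho x (- m) = - rho x m.
Proof. by rewrite -scaleN1r actZr scaleN1r. Qed.
Lemma actBr x m m' : rho x (m - m') = rho x m - rho x m'.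
Proof. by rewrite actDr actNr. Qed.

Fixpoint mfilt (i : nat) : {pred M} :=
  if i is j.+1 then fun m => `[< forall x, rho x m \in mfilt j >]
  else pred1 0.

Lemma mfilt_submod i : submod_closed (mfilt i).
Proof.
elim: i => [|i [IH0 IHD]] /=.
  split=> [|a x y]; rewrite ?inE // => /eqP -> /eqP ->.
  by rewrite scaler0 addr0.
split=> [|a m m' /asboolP mi /asboolP m'i]; apply/asboolP => x.
  by rewrite act0r.
by rewrite act_linearr IHD.
Qed.
HB.instance Definition _ i :=
  GRing.isSubmodClosed.Build k M (mfilt i) (mfilt_submod i).

Definition nilpotent_action (q : nat) : Prop :=
  [/\ (0 < q)%N, ~ (mfilt q.-1 =i predT) & mfilt q =i predT].

End Modules.

Section PullbackAction.
Variables (k : fieldType) (h g : lieType k) (pi : {lie h -> g}).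
Variables (M : lmodType k) (rho : lie_action g M).
Definition pull_act (x : h) : M -> M := rho (pi x).
Fact pull_act_linearl m : linear (pull_act^~ m).
Proof. by move=> a x y; rewrite /pull_act linearP (act_linearl rho). Qed.
Fact pull_act_linearr x : linear (pull_act x).
Proof. exact: act_linearr. Qed.
Fact pull_act_lie x y m :
  pull_act [lie x, y] m = pull_act x (pull_act y m) - pull_act y (pull_act x m).
Proof. by rewrite /pull_act lie_morph act_lie. Qed.
Definition pull_action : lie_action h M :=
  LieAction pull_act_linearl pull_act_linearr pull_act_lie.
End PullbackAction.

(** * Chevalley-Eilenberg cohomology in degrees 1 and 2 *)

(* Hom(Lambda^1 g, M) and Hom(Lambda^2 g, M) are the linear maps and the     *)
(* alternating bilinear maps; ce0, ce1, ce2 are the first differentials.     *)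
Section Cohomology.
Variables (k : fieldType) (g : lieType k) (M : lmodType k).
Variable rho : lie_action g M.

Definition cochain1 (h : g -> M) : Prop := linear h.
Definition cochain2 (w : g -> g -> M) : Prop :=
  [/\ forall y, linear (w^~ y), forall x, linear (w x) & forall x, w x x = 0].

Definition ce0 (m : M) : g -> M := fun x => rho x m.
Definition ce1 (h : g -> M) : g -> g -> M := fun x y =>
  rho x (h y) - rho y (h x) - h [lie x, y].
Definition ce2 (w : g -> g -> M) : g -> g -> g -> M := fun x y z =>
  rho x (w y z) - rho y (w x z) + rho z (w x y)
  - w [lie x, y] z + w [lie x, z] y - w [lie y, z] x.

Definition cocycle1 : {pred g -> M} := fun h =>
  `[< cochain1 h /\ forall x y, ce1 h x y = 0 >].
Definition cocycle2 : {pred g -> g -> M} := fun w =>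
  `[< cochain2 w /\ forall x y z, ce2 w x y z = 0 >].

Lemma ce0P a m m' x : ce0 (a *: m + m') x = a *: ce0 m x + ce0 m' x.
Proof. exact: act_linearr. Qed.

Let combD a (m m' u u' : M) :
  (a *: m + m') + (a *: u + u') = a *: (m + u) + (m' + u').
Proof. by rewrite addrACA scalerDr. Qed.
Let combN a (m m' : M) : - (a *: m + m') = a *: (- m) + (- m').
Proof. by rewrite opprD scalerN. Qed.

Lemma ce1P a h h' x y :
  ce1 (a *: h + h') x y = a *: ce1 h x y + ce1 h' x y.
Proof. by rewrite /ce1 !fctE /= !act_linearr !combN !combD. Qed.

Lemma ce2P a w w' x y z :
  ce2 (a *: w + w') x y z = a *: ce2 w x y z + ce2 w' x y z.
Proof. by rewrite /ce2 !fctE /= !act_linearr !combN !combD. Qed.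

Lemma cochain1P a h h' : cochain1 h -> cochain1 h' -> cochain1 (a *: h + h').
Proof.
move=> lh lh' b x y; rewrite !fctE /= lh lh' !scalerDr !scalerA.
by rewrite (mulrC b a) [LHS]addrACA.
Qed.

Lemma cochain10 : cochain1 0.
Proof. by move=> b x y; rewrite -[LHS]/(0 : M) -[RHS]/(b *: 0 + 0 : M) scaler0 addr0. Qed.

Fact cocycle1_submod : submod_closed cocycle1.
Proof.
split=> [|a u v].
  apply/asboolP; split=> [|x y]; first exact: cochain10.
  by rewrite -[LHS]/(rho x 0 - rho y 0 - 0) !act0r !subr0.
move=> /asboolP[lu cu] /asboolP[lv cv]; apply/asboolP; split=> [|x y].
  exact: cochain1P.
by rewrite ce1P cu cv scaler0 addr0.
Qed.
HB.instance Definition _ :=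
  GRing.isSubmodClosed.Build k (g -> M) cocycle1 cocycle1_submod.

Fact cocycle2_submod : submod_closed cocycle2.
Proof.
split=> [|a u v].
  apply/asboolP; split=> [|x y z].
    by split=> [y|x|x] //; apply: cochain10.
  rewrite -[LHS]/(rho x 0 - rho y 0 + rho z 0 - 0 + 0 - 0).
  by rewrite !act0r !(subr0, addr0).
move=> /asboolP[[lu ru du] cu] /asboolP[[lv rv dv] cv].
apply/asboolP; split=> [|x y z].
  split=> [y|x|x].
  - exact (@cochain1P a (u^~ y) (v^~ y) (lu y) (lv y)).
  - exact (@cochain1P a (u x) (v x) (ru x) (rv x)).
  - by rewrite !fctE /= du dv scaler0 addr0.
by rewrite ce2P cu cv scaler0 addr0.
Qed.
HB.instance Definition _ :=
  GRing.isSubmodClosed.Build k (g -> g -> M) cocycle2 cocycle2_submod.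

Definition Z1 := subm cocycle1.
HB.instance Definition _ := GRing.Lmodule.on Z1.
Definition Z2 := subm cocycle2.
HB.instance Definition _ := GRing.Lmodule.on Z2.

Lemma Z1_val a (u v : Z1) : val (a *: u + v) = a *: val u + val v.
Proof. exact: (@val_comb _ _ cocycle1). Qed.
Lemma Z2_val a (u v : Z2) : val (a *: u + v) = a *: val u + val v.
Proof. exact: (@val_comb _ _ cocycle2). Qed.

Definition B1 : {pred Z1} := fun z => `[< exists m, val z = ce0 m >].
Definition B2 : {pred Z2} := fun z =>
  `[< exists2 h, cochain1 h & val z = ce1 h >].

Fact B1_submod : submod_closed B1.
Proof.
split=> [|a u v].
  by apply/asboolP; exists 0; apply/funext => x; rewrite /ce0 act0r.
move=> /asboolP[m um] /asboolP[m' vm]; apply/asboolP; exists (a *: m + m').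
by apply/funext => x; rewrite ce0P -um -vm Z1_val.
Qed.
HB.instance Definition _ := GRing.isSubmodClosed.Build k Z1 B1 B1_submod.

Fact B2_submod : submod_closed B2.
Proof.
split=> [|a u v].
  apply/asboolP; exists 0; first exact: cochain10.
  apply/funext => x; apply/funext => y.
  by rewrite -[RHS]/(rho x 0 - rho y 0 - 0) !act0r !subr0.
move=> /asboolP[h lh uh] /asboolP[h' lh' vh]; apply/asboolP.
exists (a *: h + h'); first exact: cochain1P.
by apply/funext => x; apply/funext => y; rewrite ce1P -uh -vh Z2_val.
Qed.
HB.instance Definition _ := GRing.isSubmodClosed.Build k Z2 B2 B2_submod.

Definition H1 := lquot B1.
HB.instance Definition _ := GRing.Lmodule.on H1.
Definition H2 := lquot B2.
HB.instance Definition _ := GRing.Lmodule.on H2.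

Definition class1 (z : Z1) : H1 := lqpi B1 z.
Definition class2 (z : Z2) : H2 := lqpi B2 z.

(* The index r - i - j + 1 is a truncated subtraction: M_l = 0 for l <= 0.   *)
Definition filt2 (r : nat) (w : g -> g -> M) : Prop :=
  forall (i j : nat) (x y : g), (0 < i)%N -> (0 < j)%N ->
    x \in lcs g i -> y \in lcs g j -> w x y \in mfilt rho (r.+1 - (i + j)).

Definition FH2 (r : nat) : {pred H2} := fun c =>
  `[< exists2 z : Z2, filt2 r (val z) & class2 z = c >].

Fact FH2_submod r : submod_closed (FH2 r).
Proof.
split=> [|a u v].
  apply/asboolP; exists 0; last exact: linear0.
  by move=> i j x y _ _ _ _; apply: rpred0.
move=> /asboolP[z fz <-] /asboolP[z' fz' <-]; apply/asboolP.
exists (a *: z + z'); last exact: linearP.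
move=> i j x y i0 j0 xi yj.
have [_ cl] := mfilt_submod rho (r.+1 - (i + j)).
rewrite Z2_val; apply: cl; first exact: (fz i j).
exact: (fz' i j).
Qed.
HB.instance Definition _ r :=
  GRing.isSubmodClosed.Build k H2 (FH2 r) (FH2_submod r).

End Cohomology.

Arguments B1 {k g M} rho _.
Arguments B2 {k g M} rho _.
Arguments FH2 {k g M} rho r _.

Section Inflation.
Variables (k : fieldType) (h g : lieType k) (pi : {lie h -> g}).
Variables (M : lmodType k) (rho : lie_action g M).
Local Notation rho' := (pull_action pi rho).

Fact pull1_subproof (z : Z1 rho) : val z \o pi \in cocycle1 rho'.
Proof.
have /asboolP[lz cz] := valP z; apply/asboolP; split=> [a x y|x y] /=.
  by rewrite linearP lz.
by rewrite /ce1 /= lie_morph; apply: cz.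
Qed.
Definition pull1 (z : Z1 rho) : Z1 rho' := subm_in (pull1_subproof z).

Fact pull2_subproof (z : Z2 rho) :
  (fun x y => val z (pi x) (pi y)) \in cocycle2 rho'.
Proof.
have /asboolP[[lz rz dz] cz] := valP z; apply/asboolP; split=> [|x y t].
  split=> [y a x t|x a y t|x]; rewrite ?linearP.
  - exact: (lz (pi y)).
  - exact: (rz (pi x)).
  - exact: dz.
by rewrite /ce2 !lie_morph; apply: cz.
Qed.
Definition pull2 (z : Z2 rho) : Z2 rho' := subm_in (pull2_subproof z).

Definition inf1 (c : H1 rho) : H1 rho' := class1 (pull1 (repr c)).
Definition inf2 (c : H2 rho) : H2 rho' := class2 (pull2 (repr c)).

Lemma inf1_class z : inf1 (class1 z) = class1 (pull1 z).
Proof.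
apply/lqpiP; have /asboolP[m em] := repr_lqpi (B1 rho) z.
apply/asboolP; exists m; apply/funext => x.
exact: (congr1 (fun u => u (pi x)) em).
Qed.

Lemma inf2_class z : inf2 (class2 z) = class2 (pull2 z).
Proof.
apply/lqpiP; have /asboolP[u lu eu] := repr_lqpi (B2 rho) z.
apply/asboolP; exists (u \o pi) => [a x y|] /=; first by rewrite linearP lu.
apply/funext => x; apply/funext => y.
rewrite /ce1 /= lie_morph.
exact: (congr1 (fun u => u (pi x) (pi y)) eu).
Qed.

Fact inf1_linear : linear inf1.
Proof.
move=> a u v; rewrite -[u]lqpiK -[v]lqpiK -[_ + _](linearP (lqpi (B1 rho))).
by rewrite !inf1_class /class1 -linearP; congr (lqpi _ _); apply/val_inj.
Qed.
HB.instance Definition _ :=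
  GRing.isLinear.Build k (H1 rho) (H1 rho') *:%R inf1 inf1_linear.

Fact inf2_linear : linear inf2.
Proof.
move=> a u v; rewrite -[u]lqpiK -[v]lqpiK -[_ + _](linearP (lqpi (B2 rho))).
by rewrite !inf2_class /class2 -linearP; congr (lqpi _ _); apply/val_inj.
Qed.
HB.instance Definition _ :=
  GRing.isLinear.Build k (H2 rho) (H2 rho') *:%R inf2 inf2_linear.

End Inflation.

Section ModuleHom.
Variables (k : fieldType) (g : lieType k) (A M : lmodType k).
Variables (rhoA : lie_action g A) (rho : lie_action g M).

Definition is_homg : {pred A -> M} := fun f =>
  `[< linear f /\ forall x a, f (rhoA x a) = rho x (f a) >].

Fact is_homg_submod : submod_closed is_homg.
Proof.
split=> [|a u v].
  apply/asboolP; split=> [b x y|x m].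
    by rewrite -[LHS]/(0 : M) -[RHS]/(b *: 0 + 0 : M) scaler0 addr0.
  by rewrite -[LHS]/(0 : M) -[RHS]/(rho x 0) act0r.
move=> /asboolP[lu eu] /asboolP[lv ev]; apply/asboolP; split=> [|x m].
  move=> b x y; rewrite !fctE /= lu lv !scalerDr !scalerA.
  by rewrite (mulrC b a) [LHS]addrACA.
by rewrite !fctE /= eu ev act_linearr.
Qed.
HB.instance Definition _ :=
  GRing.isSubmodClosed.Build k (A -> M) is_homg is_homg_submod.

Definition homg := subm is_homg.
HB.instance Definition _ := GRing.Lmodule.on homg.

Fact push2_subproof (f : homg) (z : Z2 rhoA) :
  (fun x y => val f (val z x y)) \in cocycle2 rho.
Proof.
have /asboolP[lf ef] := valP f; have /asboolP[[lz rz dz] cz] := valP z.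
pose F : {linear A -> M} := HB.pack (val f) (GRing.isLinear.Build k A M *:%R (val f) lf).
apply/asboolP; split=> [|x y t].
  split=> [y a x t|x a y t|x]; rewrite ?lz ?rz ?dz ?lf //.
  exact: (linear0 F).
rewrite /ce2 -!ef -[val f]/(F : A -> M) -!(linearB, linearD).
by rewrite -/(ce2 rhoA (val z) x y t) cz linear0.
Qed.
Definition push2 (f : homg) (z : Z2 rhoA) : Z2 rho :=
  subm_in (push2_subproof f z).

End ModuleHom.

(** * Extensions with abelian kernel *)

(* [phi] represents the class of (x, y) |-> [s x, s y] - s [x, y] for a      *)
(* linear section s of p; [i] embeds the kernel A into e.                    *)
Definition corresponding_cocycle (k : fieldType) (A : lmodType k)
    (e g : lieType k) (i : A -> e) (p : e -> g) (rhoA : lie_action g A)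
    (phi : Z2 rhoA) : Prop :=
  exists (s : {linear g -> e}) (phi_s : Z2 rhoA),
    [/\ forall x, p (s x) = x,
        forall x y, i (val phi_s x y) = [lie s x, s y] - s [lie x, y]
      & class2 phi = class2 phi_s].

Section Abelianization.
Variables (k : fieldType) (f g : lieType k) (pi : {lie f -> g}).

Definition kerT := subm (lkernel pi).
HB.instance Definition _ := GRing.Lmodule.on kerT.

Definition ker_der : lieIdeal f := lie_prod (lkernel pi) (lkernel pi).

Definition ker_der_in : {pred kerT} := fun x => val x \in ker_der.
Fact ker_der_in_submod : submod_closed ker_der_in.
Proof.
split=> [|a x y]; first exact: (rpred0 ker_der).
by move=> xd yd; apply: (rpredD (S := ker_der)) => //; apply: rpredZ.
Qed.
HB.instance Definition _ :=
  GRing.isSubmodClosed.Build k kerT ker_der_in ker_der_in_submod.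

(* n / [n, n] and f / [n, n], with n = Ker pi *)
Definition ker_ab := lquot ker_der_in.
HB.instance Definition _ := GRing.Lmodule.on ker_ab.
Definition ext_ab := liequot ker_der.
HB.instance Definition _ := Lie.on ext_ab.

Definition ker_ab_pi (x : kerT) : ker_ab := lqpi ker_der_in x.
Definition ker_ab_incl (x : ker_ab) : ext_ab := lieqpi ker_der (val (repr x)).
Definition ext_ab_proj (x : ext_ab) : g := pi (repr x).

Lemma ker_ab_incl_pi x : ker_ab_incl (ker_ab_pi x) = lieqpi ker_der (val x).
Proof. by apply/lqpiP; apply: (repr_lqpi ker_der_in x). Qed.

Lemma ker_der_sub : {subset ker_der <= lkernel pi}.
Proof.
apply: (@span_min _ _ _ (lkernel pi)) => _ /asboolP[x [y [_ yk ->]]].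
exact: ideal_lbr.
Qed.

Lemma ext_ab_proj_pi x : ext_ab_proj (lieqpi ker_der x) = pi x.
Proof.
apply/eqP; rewrite -subr_eq0 -linearB.
exact/ker_der_sub/(repr_lqpi ker_der x).
Qed.

Hypothesis pi_surj : surjective pi.

Definition pi_lift (x : g) : f := sval (cid (pi_surj x)).
Lemma pi_liftK x : pi (pi_lift x) = x.
Proof. exact: svalP (cid (pi_surj x)). Qed.

Definition ker_br (x : f) (m : kerT) : kerT :=
  subm_in (ideal_lbr x _ (valP m)).

Definition ker_ab_act (x : g) (m : ker_ab) : ker_ab :=
  ker_ab_pi (ker_br (pi_lift x) (repr m)).

Lemma ker_ab_actE (x : f) (m : kerT) :
  ker_ab_act (pi x) (ker_ab_pi m) = ker_ab_pi (ker_br x m).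
Proof.
apply/lqpiP; rewrite unfold_in /=; set x' := pi_lift _; set m' := repr _.
have -> : [lie x', val m'] - [lie x, val m] =
    [lie x' - x, val m'] + [lie x, val (m' - m)].
  by rewrite lbrBl lbrBr addrA subrK.
apply: (rpredD (S := ker_der)).
  apply: mem_lie_prod; last exact: (valP m').
  by rewrite mem_lkernel linearB /= pi_liftK subrr.
by apply: ideal_lbr; apply: (repr_lqpi ker_der_in m).
Qed.

Let kpiK (m : ker_ab) : ker_ab_pi (repr m) = m. Proof. exact: lqpiK. Qed.

Let kpiP a x y :
  ker_ab_pi (a *: x + y) = a *: ker_ab_pi x + ker_ab_pi y.
Proof. exact: (linearP (lqpi ker_der_in)). Qed.

Fact ker_ab_act_linearl m : linear (ker_ab_act^~ m).
Proof.
move=> a x y; rewrite -[x]pi_liftK -[y]pi_liftK -[m]kpiK -linearP.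
rewrite !ker_ab_actE -kpiP; congr ker_ab_pi.
by apply/val_inj; rewrite /= lbrDl lbrZl.
Qed.
Fact ker_ab_act_linearr x : linear (ker_ab_act x).
Proof.
move=> a m m'; rewrite -[x]pi_liftK -[m]kpiK -[m']kpiK -kpiP.
rewrite !ker_ab_actE -kpiP; congr ker_ab_pi.
by apply/val_inj; rewrite /= lbrDr lbrZr.
Qed.
Fact ker_ab_act_lie x y m :
  ker_ab_act [lie x, y] m =
  ker_ab_act x (ker_ab_act y m) - ker_ab_act y (ker_ab_act x m).
Proof.
rewrite -[x]pi_liftK -[y]pi_liftK -[m]kpiK -lie_morph !ker_ab_actE.
rewrite -(linearB (lqpi ker_der_in)); congr ker_ab_pi.
by apply/val_inj; rewrite /= lbr_der addrK.
Qed.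
Definition ker_ab_action : lie_action g ker_ab :=
  LieAction ker_ab_act_linearl ker_ab_act_linearr ker_ab_act_lie.

Variables (M : lmodType k) (rho : lie_action g M).
Local Notation rho' := (pull_action pi rho).

(* Restriction to n of a 1-cocycle of f, as a map on n / [n, n]. *)
Definition res1_fun (z : Z1 rho') : ker_ab -> M :=
  fun m => val z (val (repr m)).

Fact Z1_linear (z : Z1 rho') : linear (val z).
Proof. by have /asboolP[] := valP z. Qed.

Let F (z : Z1 rho') : {linear f -> M} :=
  HB.pack (val z) (GRing.isLinear.Build k f M *:%R (val z) (Z1_linear z)).
Let FE z x : val z x = F z x. Proof. by []. Qed.

Let z_der (z : Z1 rho') x y :
  F z [lie x, y] = rho (pi x) (F z y) - rho (pi y) (F z x).
Proof.
have /asboolP[_ /(_ x y)/eqP] := valP z.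
by rewrite /ce1 subr_eq0 => /eqP/esym.
Qed.

Let act_ker x m : x \in lkernel pi -> rho (pi x) m = 0.
Proof.
rewrite mem_lkernel => /eqP ->; apply: (addrI (rho 0 m)).
by have := act_linearl rho m 1 0 0; rewrite !scale1r !addr0 => <-.
Qed.

Let z_ker_der (z : Z1 rho') x : x \in ker_der -> F z x = 0.
Proof.
move=> xd; apply/eqP; rewrite -mem_lkernel.
apply: (@span_min _ _ _ (lkernel (F z))) xd => _ /asboolP[a [b [ak bk ->]]].
by rewrite mem_lkernel z_der !act_ker // subr0.
Qed.

Lemma res1_fun_pi z m : res1_fun z (ker_ab_pi m) = val z (val m).
Proof.
rewrite /res1_fun !FE; apply/eqP; rewrite -subr_eq0 -linearB; apply/eqP.
exact/z_ker_der/(repr_lqpi ker_der_in m).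
Qed.

Fact res1_subproof (z : Z1 rho') : res1_fun z \in is_homg ker_ab_action rho.
Proof.
apply/asboolP; split=> [a m m'|x m].
  rewrite -[m]kpiK -[m']kpiK -kpiP !res1_fun_pi !FE.
  by rewrite (val_comb (S := lkernel pi)) linearP.
rewrite -[x]pi_liftK -[m]kpiK -[ker_ab_action _ _]/(ker_ab_act _ _).
rewrite ker_ab_actE !res1_fun_pi -[LHS]/(F z [lie pi_lift x, val (repr m)]).
by rewrite z_der (act_ker _ (valP (repr m))) subr0.
Qed.
Definition res1_cocycle (z : Z1 rho') : homg ker_ab_action rho :=
  subm_in (res1_subproof z).

Definition res1 (c : H1 rho') : homg ker_ab_action rho := res1_cocycle (repr c).

Lemma res1_class z : res1 (class1 z) = res1_cocycle z.
Proof.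
apply/val_inj/funext => m /=; rewrite -[m]kpiK !res1_fun_pi.
have /asboolP[v ev] := repr_lqpi (B1 rho') z.
apply/eqP; rewrite -subr_eq0; apply/eqP.
rewrite [LHS](congr1 (fun u => u (val (repr m))) ev).
exact: act_ker _ (valP (repr m)).
Qed.

Fact res1_linear : linear res1.
Proof.
move=> a u v; rewrite -[u]lqpiK -[v]lqpiK -[_ + _](linearP (lqpi (B1 rho'))).
by rewrite !res1_class; apply/val_inj/funext => m.
Qed.
HB.instance Definition _ :=
  GRing.isLinear.Build k (H1 rho') (homg ker_ab_action rho) *:%R
    res1 res1_linear.

End Abelianization.

Arguments ker_ab_incl {k f g} pi x.
Arguments ext_ab_proj {k f g} pi x.
Arguments res1 {k f g pi} pi_surj {M} rho c.
Arguments corresponding_cocycle {k A e g} i p {rhoA} phi.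
Arguments inf1 {k h g} pi {M} rho c.
Arguments inf2 {k h g} pi {M} rho c.

(* Main.v *)
Require Import Defs.
From HB Require Import structures.
From mathcomp Require Import all_boot all_order all_algebra.
From mathcomp Require Import boolp functions.

Import GRing.Theory.
Set Implicit Arguments.
Unset Strict Implicit.
Unset Printing Implicit Defensive.
Local Open Scope ring_scope.

(** Write f for the free nilpotent algebra and n for the kernel of pi.

    The exact sequence is the low-degree part of the Hochschild-Serre sequence
    of n in f, proved by hand with a linear section s of pi: a homomorphism
    F : n/[n,n] -> M of g-modules extends to the cochain F(x - s(pi x)) of f,
    whose coboundary is minus the pullback of F o phi_s ([ce1_hom_ext]), and
    conversely a cochain of f whose coboundary is pulled back from g restricts
    to a homomorphism of g-modules on n ([homg_of_cochain]).  Here phi_s(x, y)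
    is the class of [s x, s y] - s [x, y].  Hence the connecting map that
    sends F to the class of F o phi_s reaches every class killed by inflation
    ([ker_inf2]), and its kernel is the image of restriction
    ([ker_connecting]).  It remains to see that inflation kills F_r H^2 and
    that F_r H^2 contains the image of the connecting map: then these two and
    the kernel of inflation coincide.

    A class in F_r H^2 dies on f because f is free.  A cocycle z in F_r
    defines an extension of g by M, and the condition defining F_r says
    exactly what puts the i-th term of the lower central series of this
    extension inside M_(r+1-i) x g^i ([twist_lcs]).  Since M_0 = 0, the
    M-component of the map from the free Lie algebra that lifts pi on the
    generators vanishes on the term of index r+1, hence is defined on f, and
    there it bounds the pullback of z up to sign ([filt2_inf2]).

    Conversely every class of the form F o phi_s is in F_r H^2.  Acting r+1-l
    times on an element of n in f^l gives an element of f^(r+1) = 0, so F maps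
    the intersection of n and f^l to M_(r+1-l) ([homg_mfilt]).  If s maps each
    g^i to f^i, which can be arranged ([filtered_section]), then phi_s maps
    g^i x g^j to classes of elements of f^(i+j), and F o phi_s lies in F_r
    ([connecting_FH2]).

    When M is trivial, cocycles of f vanish on [f,f], which contains n, so
    restriction to n is zero and the connecting map is injective
    ([res1_trivial]). *)

(** * Functions known to be linear, and sums in abelian groups *)

Section LinearFun.
Variables (k : fieldType) (V W : lmodType k) (h : V -> W) (h_lin : linear h).
Let H : {linear V -> W} := HB.pack h (GRing.isLinear.Build k V W *:%R h h_lin).
Lemma linear_fun0 : h 0 = 0. Proof. exact: (linear0 H). Qed.
Lemma linear_funN x : h (- x) = - h x. Proof. exact: (linearN H). Qed.
Lemma linear_funD x y : h (x + y) = h x + h y. Proof. exact: (linearD H). Qed.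
Lemma linear_funB x y : h (x - y) = h x - h y. Proof. exact: (linearB H). Qed.
End LinearFun.

(** Proves an identity between signed sums by moving everything to one side
    and repeatedly cancelling the last term against its opposite.  It presumes
    that no term occurs twice with the same sign. *)
Ltac abel := apply/eqP; rewrite -subr_eq0 ?(opprD, opprK, addrA);
  rewrite -[eqbLHS]add0r ?addrA ?subr0;
  repeat (match goal with
  | |- is_true (_ + - ?u == 0) => rewrite ?(addrAC _ u) subrK
  | |- is_true (_ + ?u == 0) => rewrite ?(addrAC _ (- u)) addrK
  end); exact: eqxx.

(** * Lower central series and the filtration of a module *)

Lemma span_ind (k : fieldType) (V : lmodType k) (A : {pred V}) (P : V -> Prop) :
  P 0 -> (forall a x y, P x -> P y -> P (a *: x + y)) ->
  (forall x, x \in A -> P x) -> forall x, x \in Defs.span A -> P x.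
Proof.
move=> P0 PD PA x /asboolP[s sA ->]; elim: s sA => [|u s IH] /=.
  by rewrite big_nil.
by case/andP=> /PA Pu /IH Ps; rewrite big_cons; apply: PD.
Qed.

Lemma lcs_ind (k : fieldType) (L : lieType k) i (P : L -> Prop) :
  (0 < i)%N -> P 0 -> (forall a x y, P x -> P y -> P (a *: x + y)) ->
  (forall a b, b \in lcs L i -> P [lie a, b]) ->
  forall x, x \in lcs L i.+1 -> P x.
Proof.
case: i => // i _ P0 PD Pbr; apply: span_ind => // _ /asboolP[a [b [_ bi ->]]].
exact: Pbr.
Qed.

Lemma lcs_br (k : fieldType) (L : lieType k) i a b :
  (0 < i)%N -> b \in lcs L i -> [lie a, b] \in lcs L i.+1.
Proof. by case: i => // i _ bi; apply: mem_lie_prod. Qed.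

(** Induction on i: by the Jacobi identity a bracket with [a, b], for b in
    L^i, is a difference of iterated brackets in which b occurs alone. *)
Lemma lcs_lbr (k : fieldType) (L : lieType k) i j (x y : L) :
  (0 < i)%N -> (0 < j)%N -> x \in lcs L i -> y \in lcs L j ->
  [lie x, y] \in lcs L (i + j).
Proof.
case: i => // i _; elim: i j x y => [|i IH] j x y j0 xi yj.
  by rewrite add1n lcs_br.
move: x xi y yj; apply: lcs_ind => // [y _|a x x' Hx Hx' y yj|a b bi y yj].
- by rewrite lbr0l rpred0.
- by rewrite lbrDl lbrZl rpredD ?rpredZ ?Hx ?Hx'.
have -> : [lie [lie a, b], y] = [lie a, [lie b, y]] - [lie b, [lie a, y]].
  by rewrite (lbr_der a) addrK.
apply: rpredB; first by rewrite addSn lcs_br ?IH // addn_gt0 j0 orbT.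
by rewrite addSnnS IH ?lcs_br.
Qed.

Lemma lcs_morph (k : fieldType) (L1 L2 : lieType k) (f : {lie L1 -> L2}) i x :
  x \in lcs L1 i -> f x \in lcs L2 i.
Proof.
case: i => // i; elim: i x => [|i IH] // x.
move: x; apply: lcs_ind => // [|a x y fx fy|a b bi].
- by rewrite linear0 rpred0.
- by rewrite linearP rpredD ?rpredZ.
by rewrite lie_morph lcs_br ?IH.
Qed.

(** Surjective morphisms map the lower central series onto the lower central
    series; this is what makes sections compatible with it possible. *)
Lemma lcs_lift (k : fieldType) (L1 L2 : lieType k) (f : {lie L1 -> L2}) i y :
  surjective f -> y \in lcs L2 i -> exists2 x, x \in lcs L1 i & f x = y.
Proof.
move=> fsurj; have triv z : exists2 x, x \in predT & f x = z.
  by have [x <-] := fsurj z; exists x.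
case: i => [_|i]; first exact: triv.
elim: i y => [|i IH] y; first by move=> _; apply: triv.
move: y; apply: lcs_ind => // [|a _ _ [x xi <-] [x' x'i <-]|a b bi].
- by exists 0; rewrite ?rpred0 ?linear0.
- by exists (a *: x + x'); rewrite ?linearP ?rpredD ?rpredZ.
have [x xi <-] := IH b bi; have [a' <-] := fsurj a.
by exists [lie a', x]; rewrite ?lie_morph ?lcs_br.
Qed.

Lemma freenil_lcs0 (k : fieldType) n r (x : freenil k n r) :
  x \in lcs (freenil k n r) r.+1 -> x = 0.
Proof.
move=> xr; have [] := @lcs_lift _ _ _ (freenil_pi k n r) r.+1 x _ xr.
  by move=> y; exists (repr y); rewrite /= lieqpiK.
by move=> t tr <-; apply/lqpi_eq0.
Qed.

Lemma mfiltS (k : fieldType) (g : lieType k) (M : lmodType k)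
    (rho : lie_action g M) i x m :
  m \in mfilt rho i -> rho x m \in mfilt rho i.-1.
Proof.
case: i => [|i] /=; first by rewrite !inE => /eqP ->; rewrite act0r.
by move=> /asboolP.
Qed.

Lemma act0l (k : fieldType) (g : lieType k) (M : lmodType k)
    (rho : lie_action g M) m : rho 0 m = 0.
Proof.
apply: (addrI (rho 0 m)).
by have := act_linearl rho m 1 0 0; rewrite !scale1r !addr0.
Qed.

(** By [act_lie] an element of g^i acts as a combination of products of i
    elements of g, each of which lowers the filtration index by one. *)
Lemma act_lcs (k : fieldType) (g : lieType k) (M : lmodType k)
    (rho : lie_action g M) i j x m :
  (0 < i)%N -> x \in lcs g i -> m \in mfilt rho j ->
  rho x m \in mfilt rho (j - i).
Proof.
case: i => // i _; elim: i j x m => [|i IH] j x m.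
  by move=> _; rewrite subn1; apply: mfiltS.
move=> xi; move: x xi m.
apply: lcs_ind => // [m _|a x y Hx Hy m mj|a b bi m mj].
- by rewrite act0l rpred0.
- by rewrite act_linearl rpredD ?rpredZ ?Hx ?Hy.
rewrite act_lie; apply: rpredB.
  by rewrite subnS; apply/mfiltS/IH.
have -> : (j - i.+2 = j.-1 - i.+1)%N by rewrite -subn1 -subnDA.
by apply: IH => //; apply: mfiltS.
Qed.

Lemma mfilt_subset (k : fieldType) (g : lieType k) (M : lmodType k)
    (rho : lie_action g M) i j :
  (i <= j)%N -> {subset mfilt rho i <= mfilt rho j}.
Proof.
elim: i j => [|i IH] j.
  by move=> _ m; rewrite inE => /eqP ->; exact: rpred0.
case: j => // j; rewrite ltnS => /IH sub m /asboolP mi.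
by apply/asboolP => x; apply: sub.
Qed.

(** * Linear sections compatible with the lower central series *)

(** Gives access to complements and bases for the terms of the lower central
    series of g.  A subspace of S of maximal dimension absorbs every line
    of S. *)
Lemma submod_vspace (k : fieldType) (V : vectType k) (S : submodClosed V) :
  exists U : {vspace V}, U =i S.
Proof.
pose P d := `[< exists2 U : {vspace V}, \dim U = d & {subset U <= S} >].
have P0 : exists d, P d.
  exists 0%N; apply/asboolP; exists 0%VS; rewrite ?dimv0 // => x.
  by rewrite memv0 => /eqP ->; apply: rpred0.
have Pmax d : P d -> (d <= \dim {:V})%N.
  by move=> /asboolP[U <- _]; rewrite dimvS ?subvf.
case: (ex_maxnP P0 Pmax) => d /asboolP[U <- US] Umax; exists U => x.
apply/idP/idP => [/US //|xS].
have/Umax: P (\dim (U + <[x]>)).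
  apply/asboolP; exists (U + <[x]>)%VS => // y /memv_addP[u uU [v vx ->]].
  by have /vlineP[a ->] := vx; apply: rpredD; [exact: US|exact: rpredZ].
move=> dle; have /eqP -> : U == (U + <[x]>)%VS.
  by rewrite eqEdim addvSl dle.
by apply: (subvP (addvSr _ _)); apply: memv_line.
Qed.

Lemma linear_lift (k : fieldType) (V : vectType k) (W : lmodType k)
    (f : {linear W -> V}) (U : {vspace V}) (S : submodClosed W) :
  (forall y, y \in U -> exists2 x, x \in S & f x = y) ->
  exists2 t : {linear V -> W}, {in U, cancel t f} & forall y, t y \in S.
Proof.
move=> lift.
have lift' (i : 'I_(\dim U)) : exists x, x \in S /\ f x = (vbasis U)`_i.
  have [|x xS fx] := lift (vbasis U)`_i; last by exists x.
  by apply/vbasis_mem/mem_nth; rewrite size_tuple.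
have [b bP] := choice lift'.
pose t y := \sum_i coord (vbasis U) i y *: b i.
have t_lin : linear t.
  move=> a y y'; rewrite /t scaler_sumr -big_split; apply: eq_bigr => i _ /=.
  by rewrite linearP scalerDl scalerA.
pose T : {linear V -> W} := HB.pack t (GRing.isLinear.Build k V W *:%R t t_lin).
exists T => [y yU|y]; rewrite /T /=.
  rewrite /t linear_sum [RHS](coord_vbasis yU); apply: eq_bigr => i _.
  by rewrite linearZ /= (bP i).2.
by apply: rpred_sum => i _; rewrite rpredZ ?(bP i).1.
Qed.

(** The section is built from the bottom of the flag of the g^i, starting with
    zero on g^(p+1) = 0.  To go from g^(l+1) to g^l, the old section is kept
    on the projection to g^(l+1) and the rest is lifted to f^l, which
    [lcs_lift] allows. *)
Lemma filtered_section (k : fieldType) (f : lieType k) (g : finLieType k)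
    (pi : {lie f -> g}) p :
  surjective pi -> lcs g p.+1 =i pred1 0 ->
  exists2 s : {linear g -> f}, cancel s pi &
    forall i x, x \in lcs g i -> s x \in lcs f i.
Proof.
move=> pi_surj g_nil.
have [i|U UE] := choice (P := fun i (U : {vspace g}) => U =i lcs g i).
  exact: submod_vspace.
(* [j] counts the terms of the flag already treated, from the bottom up. *)
suff step j : (j <= p.+1)%N -> exists2 s : {linear g -> f},
    {in U (p.+1 - j)%N, cancel s pi} &
    forall i x, (p.+1 - j <= i)%N -> x \in U i -> s x \in lcs f i.
  have [//|s sK sF] := step p.+1; rewrite subnn in sK sF.
  exists s => [x|i x xi]; last by rewrite sF ?UE.
  by rewrite sK // UE.
elim: j => [_|j IH jp].
  exists (GRing.null_fun f : {linear g -> f}) => [x|i x _]; rewrite ?subn0 UE.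
    by rewrite g_nil => /eqP ->; rewrite !linear0.
  by move=> _; apply: rpred0.
have [s sK sF] := IH (ltnW jp); have jE : (p.+1 - j = (p.+1 - j.+1).+1)%N.
  by rewrite subnSK.
rewrite jE in sK sF; move: (p.+1 - j.+1)%N sK sF => l sK sF.
have [|t tK tF] := @linear_lift _ _ _ pi (U l) (lcs f l).
  by move=> y; rewrite UE; apply: lcs_lift.
pose P := projv (U l.+1).
have UlS : (U l.+1 <= U l)%VS.
  by apply/subvP => x; rewrite !UE; apply: lcs_subset.
pose s' x := s (P x) + t (x - P x).
have s'_lin : linear s'.
  move=> a x y; rewrite /s' linearP linearP /=.
  have -> : a *: x + y - (a *: P x + P y) = a *: (x - P x) + (y - P y).
    by rewrite scalerBr opprD addrACA.
  by rewrite linearP scalerDr addrACA.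
have PU x : P x \in U l.+1 by apply: memv_proj.
pose s1 : {linear g -> f} :=
  HB.pack s' (GRing.isLinear.Build k g f *:%R s' s'_lin).
exists s1 => [x xl|i x]; rewrite /s1 /=.
  rewrite /s' linearD /= sK // tK ?subrKC // rpredB //.
  exact: (subvP UlS).
rewrite leq_eqVlt => /orP[/eqP <-|li] xi.
  rewrite /s' rpredD ?tF //; apply: (@lcs_subset _ _ l l.+1) => //.
  exact: sF.
have xl : x \in U l.+1 by move: xi; rewrite !UE; apply: lcs_subset.
by rewrite /s' projv_id // subrr linear0 addr0 sF.
Qed.

(** * The cocycle of an extension with abelianized kernel *)

Lemma class2_linear (k : fieldType) (g : lieType k) (M : lmodType k)
    (rho : lie_action g M) : linear (@class2 _ _ _ rho).
Proof. exact: lqpi_linear. Qed.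

Lemma class2_eq (k : fieldType) (g : lieType k) (M : lmodType k)
    (rho : lie_action g M) (z z' : Z2 rho) :
  class2 z = class2 z' <->
  exists2 h, linear h & forall x y, val z x y = val z' x y + ce1 rho h x y.
Proof.
split=> [/lqpiP/asboolP[h lh zh]|[h lh zh]].
  exists h => // x y; rewrite -[ce1 _ _]zh.
  by rewrite -[val (z - z') x y]/(val z x y - val z' x y) subrKC.
apply/lqpiP/asboolP; exists h => //; apply/funext => x; apply/funext => y.
by rewrite -[LHS]/(val z x y - val z' x y) zh addrC addKr.
Qed.

Lemma class2_eq0 (k : fieldType) (g : lieType k) (M : lmodType k)
    (rho : lie_action g M) (z : Z2 rho) :
  class2 z = 0 <-> exists2 h, linear h & forall x y, val z x y = ce1 rho h x y.
Proof.
rewrite -(linear_fun0 (@class2_linear _ _ _ rho)) class2_eq.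
by split=> -[h h_lin zh]; exists h => // x y;
  rewrite zh ?add0r // [X in X + _]/(0 : M) add0r.
Qed.

Lemma Z1P (k : fieldType) (g : lieType k) (M : lmodType k)
    (rho : lie_action g M) (h : g -> M) :
  linear h -> (forall x y, ce1 rho h x y = 0) -> exists z : Z1 rho, val z = h.
Proof.
move=> h_lin hc; have hZ : h \in cocycle1 rho by apply/asboolP.
by exists (subm_in hZ).
Qed.

Section LowDegree.
Variables (k : fieldType) (f g : lieType k) (pi : {lie f -> g}).
Hypothesis pi_surj : surjective pi.
Local Notation kact := (ker_ab_action pi_surj).

Lemma ker_ab_pi_linear : linear (@ker_ab_pi _ _ _ pi).
Proof. exact: (lqpi_linear (@ker_der_in _ _ _ pi)). Qed.
HB.instance Definition _ :=
  GRing.isLinear.Build k (kerT pi) (ker_ab pi) *:%R (@ker_ab_pi _ _ _ pi)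
    ker_ab_pi_linear.

Lemma ker_ab_actionE x m : kact (pi x) (ker_ab_pi m) = ker_ab_pi (ker_br x m).
Proof. exact: ker_ab_actE. Qed.

Lemma ker_ab_incl_linear : linear (ker_ab_incl pi).
Proof.
move=> a x y; rewrite -[x]lqpiK -[y]lqpiK -[_ + _]ker_ab_pi_linear.
by rewrite !ker_ab_incl_pi -linearP.
Qed.
HB.instance Definition _ :=
  GRing.isLinear.Build k (ker_ab pi) (ext_ab pi) *:%R (ker_ab_incl pi)
    ker_ab_incl_linear.

Lemma ker_ab_incl_inj : injective (ker_ab_incl pi).
Proof.
move=> x y; rewrite -[x]lqpiK -[y]lqpiK !ker_ab_incl_pi => /lqpiP xy.
exact/lqpiP.
Qed.

Lemma ker_ab_incl_im (e : ext_ab pi) :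
  ext_ab_proj pi e = 0 -> exists m, ker_ab_incl pi m = e.
Proof.
rewrite -[e]lieqpiK ext_ab_proj_pi => /eqP ek.
by exists (ker_ab_pi (@subm_in _ _ (lkernel pi) _ ek)); rewrite ker_ab_incl_pi.
Qed.

Lemma ext_ab_proj_linear : linear (ext_ab_proj pi).
Proof.
move=> a x y; rewrite -[x]lieqpiK -[y]lieqpiK -linearP.
by rewrite !ext_ab_proj_pi linearP.
Qed.
HB.instance Definition _ :=
  GRing.isLinear.Build k (ext_ab pi) g *:%R (ext_ab_proj pi) ext_ab_proj_linear.

Lemma ker_ab_incl_act (e : ext_ab pi) m :
  ker_ab_incl pi (ker_ab_action pi_surj (ext_ab_proj pi e) m) =
  [lie e, ker_ab_incl pi m].
Proof.
rewrite -[e]lieqpiK ext_ab_proj_pi -[m]lqpiK.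
by rewrite [ker_ab_action _ _ _]ker_ab_actE !ker_ab_incl_pi lieqpi_morph.
Qed.

Lemma ext_ab_proj_incl m : ext_ab_proj pi (ker_ab_incl pi m) = 0.
Proof.
rewrite -[m]lqpiK ker_ab_incl_pi ext_ab_proj_pi.
by apply/eqP; rewrite -mem_lkernel; apply: valP.
Qed.

Lemma ker_ab_incl_br m m' : [lie ker_ab_incl pi m, ker_ab_incl pi m'] = 0.
Proof. by rewrite -ker_ab_incl_act ext_ab_proj_incl act0l linear0. Qed.

Variables (s : {linear g -> f}) (sK : cancel s pi).

Fact section_defect_subproof x y : [lie s x, s y] - s [lie x, y] \in lkernel pi.
Proof. by rewrite mem_lkernel linearB /= lie_morph !sK subrr. Qed.
Definition section_defect x y : kerT pi :=
  subm_in (section_defect_subproof x y).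
Definition section_fun x y : ker_ab pi := ker_ab_pi (section_defect x y).

Lemma section_fun_subproof : section_fun \in cocycle2 kact.
Proof.
apply/asboolP; split=> [|x y z].
  split=> [y a x x'|x a y y'|x].
  - rewrite /section_fun -ker_ab_pi_linear; congr ker_ab_pi.
    apply/val_inj => /=.
    rewrite !(lbrDl, linearP, lbrZl) /=.
    by rewrite scalerDr addrACA.
  - rewrite /section_fun -ker_ab_pi_linear; congr ker_ab_pi.
    apply/val_inj => /=.
    rewrite !(lbrDr, linearP, lbrZr) /=.
    by rewrite scalerDr addrACA.
  - rewrite /section_fun -[RHS](linear0 (@ker_ab_pi _ _ _ pi)); congr ker_ab_pi.
    by apply/val_inj; rewrite /= !lbrxx linear0 subrr.
have actE u m : kact u (ker_ab_pi m) = ker_ab_pi (ker_br (s u) m).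
  by rewrite -ker_ab_actionE sK.
rewrite /ce2 /section_fun !actE -!(linearB, linearD).
rewrite -[RHS](linear0 (@ker_ab_pi _ _ _ pi)).
(* The six terms sum to zero in n itself, before passing to the quotient:    *)
(* the Jacobi identity of f for s x, s y, s z and that of g under s.         *)
congr ker_ab_pi; apply/val_inj => /=.
rewrite !(lbrBr, lbrBl).
rewrite !(lbrC _ (s [lie _, _])) (lbrC (s z)) (lbr_der (s x)).
rewrite (lbrC [lie _, _] y) (lbrC [lie _, _] x) (lbr_der x).
rewrite !(linearN s) (linearD s).
by abel.
Qed.

Definition section_cocycle : Z2 kact := subm_in section_fun_subproof.

Local Notation phi_s := section_cocycle.

(** The class of the cocycle does not depend on the section.  Two sections
    into f/[n,n] differ by a map u into n/[n,n]; as brackets of elements of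
    n/[n,n] vanish, their cocycles differ by the coboundary of u. *)
Lemma corresponding_class (phi : Z2 kact) :
  corresponding_cocycle (ker_ab_incl pi) (ext_ab_proj pi) phi ->
  class2 phi = class2 phi_s.
Proof.
move=> [s' [phi' [s'K phi'E ->]]].
pose t x : ext_ab pi := lieqpi (ker_der pi) (s x).
have t_lin : linear t by move=> a x y; rewrite /t !linearP.
have tK x : ext_ab_proj pi (t x) = x by rewrite ext_ab_proj_pi sK.
have [x|u uE] := choice (P := fun x m => ker_ab_incl pi m = s' x - t x).
  by apply: ker_ab_incl_im; rewrite linearB /= s'K tK subrr.
have u_lin : linear u.
  move=> a x y; apply: ker_ab_incl_inj.
  rewrite ker_ab_incl_linear !uE linearP t_lin.
  by rewrite scalerBr opprD addrACA.
have inclD m m' :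
    ker_ab_incl pi (m + m') = ker_ab_incl pi m + ker_ab_incl pi m'.
  exact: linearD.
have inclB m m' :
    ker_ab_incl pi (m - m') = ker_ab_incl pi m - ker_ab_incl pi m'.
  exact: linearB.
have actE x m : ker_ab_incl pi (kact x m) = [lie t x, ker_ab_incl pi m].
  by rewrite -ker_ab_incl_act tK.
apply/class2_eq; exists u => // x y; apply: ker_ab_incl_inj.
rewrite phi'E inclD ker_ab_incl_pi /= linearB /= lieqpi_morph !inclB !actE.
have s'E z : s' z = t z + ker_ab_incl pi (u z) by rewrite uE subrKC.
rewrite -!/(t _) !s'E lbrDl !lbrDr ker_ab_incl_br addr0.
by rewrite (lbrC (ker_ab_incl pi (u x))); abel.
Qed.

(** * The low-degree exact sequence *)

Variables (M : lmodType k) (rho : lie_action g M).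
Local Notation rho' := (pull_action pi rho).
Local Notation homN := (homg kact rho).

Lemma homg_lin (F : homN) : linear (val F).
Proof. by have /asboolP[] := valP F. Qed.
(** Packing with a linear structure gives access to the theory of linear
    maps, which the subtype of homomorphisms does not carry. *)
Definition homg_linear (F : homN) : {linear ker_ab pi -> M} :=
  HB.pack (val F)
    (GRing.isLinear.Build k (ker_ab pi) M *:%R (val F) (homg_lin F)).
Lemma homgE (F : homN) m : val F m = homg_linear F m. Proof. by []. Qed.
Lemma homg_act (F : homN) x m : val F (kact x m) = rho x (val F m).
Proof. by have /asboolP[] := valP F. Qed.

Definition connecting (F : homN) : H2 rho := class2 (push2 F phi_s).

Lemma connecting_linear : linear connecting.
Proof.
move=> a F G; rewrite /connecting /class2 -linearP; congr (lqpi _ _).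
exact/val_inj.
Qed.
HB.instance Definition _ :=
  GRing.isLinear.Build k homN (H2 rho) *:%R connecting connecting_linear.

Lemma class2_push2 (F : homN) (phi phi' : Z2 kact) :
  class2 phi = class2 phi' -> class2 (push2 F phi) = class2 (push2 F phi').
Proof.
move=> /class2_eq[u u_lin phiE]; apply/class2_eq; exists (val F \o u).
  by move=> a x y; rewrite /= u_lin !homgE linearP.
move=> x y; rewrite /= phiE !homgE linearD; congr (_ + _).
by rewrite /ce1 !linearB -!homgE !homg_act.
Qed.

Fact ker_part_subproof x : x - s (pi x) \in lkernel pi.
Proof. by rewrite mem_lkernel linearB /= sK subrr. Qed.
Definition ker_part x : kerT pi := subm_in (ker_part_subproof x).
Definition hom_ext (F : homN) (x : f) : M := val F (ker_ab_pi (ker_part x)).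

Lemma hom_ext_linear F : linear (hom_ext F).
Proof.
move=> a x y; rewrite /hom_ext !homgE -linearP -ker_ab_pi_linear.
congr (val F (ker_ab_pi _)).
by apply/val_inj; rewrite /= !linearP /= scalerDr addrACA.
Qed.

Lemma hom_ext_ker F (m : kerT pi) : hom_ext F (val m) = val F (ker_ab_pi m).
Proof.
congr (val F (ker_ab_pi _)); apply/val_inj; rewrite /=.
by have := valP m; rewrite mem_lkernel => /eqP ->; rewrite linear0 subr0.
Qed.

(** The extension of F by zero on the image of s fails to be a cocycle only
    because s is not a morphism, and phi_s measures that failure. *)
Lemma ce1_hom_ext F x y :
  ce1 rho' (hom_ext F) x y = - val F (section_fun (pi x) (pi y)).
Proof.
rewrite /ce1 /= /pull_act -!homg_act !ker_ab_actionE !homgE -!linearB -linearN.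
congr (homg_linear F _).
rewrite /section_fun -[RHS](linearN (@ker_ab_pi _ _ _ pi)).
apply/lqpiP; apply: mem_span.
(* The two sides differ in n by a bracket of elements of n. *)
apply/asboolP; exists (x - s (pi x)), (y - s (pi y)).
split; rewrite ?ker_part_subproof //= lie_morph !(lbrDl, lbrDr, lbrNl, lbrNr).
by rewrite (lbrC y x) (lbrC y (s _)); abel.
Qed.

(** The pullback of w vanishes at (x, y) as soon as x or y is in n, so the
    condition on h makes h equivariant on n and zero on [n,n].  Composing h
    with s exhibits the connecting class as the opposite of that of w.  The
    case w = 0 is that of cocycles of f; a general w is what inflation to f
    kills. *)
Lemma homg_of_cochain (h : f -> M) (w : Z2 rho) :
  linear h -> (forall x y, ce1 rho' h x y = val w (pi x) (pi y)) ->
  exists2 F : homN, forall m, val F (ker_ab_pi m) = h (val m) &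
    connecting F = - class2 w.
Proof.
move=> h_lin hw; have /asboolP[[wl wr wd] _] := valP w.
have w0r x : val w x 0 = 0 := linear_fun0 (wr x).
have w0l y : val w 0 y = 0 := linear_fun0 (wl y).
have Hbr x y :
    h [lie x, y] = rho (pi x) (h y) - rho (pi y) (h x) - val w (pi x) (pi y).
  by rewrite -hw /ce1 subKr.
have ker0 x : x \in lkernel pi -> pi x = 0 by rewrite mem_lkernel => /eqP.
have h_der x : x \in ker_der pi -> h x = 0.
  move=> xd; move: x xd; apply: span_ind => [|a u v hu hv|x /asboolP[a [b []]]].
  - exact: linear_fun0.
  - by rewrite h_lin hu hv scaler0 addr0.
  - by move=> /ker0 ak /ker0 bk ->; rewrite Hbr ak bk !act0l w0l !subr0.
pose F (m : ker_ab pi) : M := h (val (repr m)).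
have FE (m : kerT pi) : F (ker_ab_pi m) = h (val m).
  apply/eqP; rewrite -subr_eq0 -(linear_funB h_lin); apply/eqP.
  by apply: h_der; exact: (repr_lqpi (@ker_der_in _ _ _ pi) m).
have F_hom : F \in is_homg kact rho.
  apply/asboolP; split=> [a m m'|x m].
    by rewrite -[m]lqpiK -[m']lqpiK -[a *: _ + _]ker_ab_pi_linear !FE -h_lin.
  have [{}x <-] := pi_surj x.
  rewrite -[m]lqpiK [kact _ _]ker_ab_actionE !FE Hbr.
  by rewrite (ker0 _ (valP (repr m))) w0r act0l !subr0.
exists (subm_in F_hom) => //.
rewrite /connecting -(linear_funN (@class2_linear _ _ _ rho)).
apply/class2_eq; exists (h \o s) => [a x y|x y].
  by rewrite /= linearP h_lin.
rewrite -[LHS]/(F (section_fun x y)) FE /= (linear_funB h_lin) Hbr !sK.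
by rewrite -[(- _) x y]/(- val w x y) /ce1 /=; abel.
Qed.

Lemma ker_inf2 c : inf2 pi rho c = 0 -> exists F : homN, connecting F = c.
Proof.
rewrite -[c]lqpiK inf2_class => /class2_eq0[h h_lin ch].
have [x y|F _ connF] := homg_of_cochain (w := repr c) h_lin.
  by rewrite -ch.
by exists (- F); rewrite linearN /= connF opprK.
Qed.

(** If u bounds the cocycle F o phi_s on g, then adding the pullback of u to
    the extension of F yields a cocycle of f that restricts to F. *)
Lemma ker_connecting (F : homN) :
  connecting F = 0 <-> exists c, res1 pi_surj rho c = F.
Proof.
split=> [/class2_eq0[u u_lin cu]|[c <-]].
  pose h x := u (pi x) + hom_ext F x.
  have h_lin : linear h.
    by move=> a x y; rewrite /h !linearP u_lin hom_ext_linear scalerDr addrACA.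
  have hc x y : ce1 rho' h x y = 0.
    transitivity (ce1 rho u (pi x) (pi y) + ce1 rho' (hom_ext F) x y).
      by rewrite /ce1 /h /= /pull_act lie_morph !actDr; abel.
    by rewrite ce1_hom_ext -cu subrr.
  have [z zE] := Z1P h_lin hc.
  exists (class1 z); rewrite res1_class; apply/val_inj/funext => m /=.
  rewrite -[m]lqpiK res1_fun_pi zE /h hom_ext_ker.
  have := valP (repr m); rewrite mem_lkernel => /eqP ->.
  by rewrite (linear_fun0 u_lin) add0r.
rewrite -[c]lqpiK res1_class; have /asboolP[z_lin zc] := valP (repr c).
have [x y|G GE connG] := homg_of_cochain (w := (0 : Z2 rho)) z_lin.
  exact: zc.
have -> : res1_cocycle pi_surj (repr c) = G.
  by apply/val_inj/funext => m; rewrite -[m]lqpiK [RHS]GE -res1_fun_pi.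
by rewrite connG (linear_fun0 (@class2_linear _ _ _ rho)) oppr0.
Qed.

(** A cocycle that vanishes on n is constant on the fibres of pi, hence is the
    pullback of its composite with s. *)
Lemma ker_res1 c : res1 pi_surj rho c = 0 <-> exists c', inf1 pi rho c' = c.
Proof.
split=> [|[c' <-]]; last first.
  rewrite -[c']lqpiK inf1_class res1_class; apply/val_inj/funext => m /=.
  rewrite -[m]lqpiK res1_fun_pi /=.
  have := valP (repr m); rewrite mem_lkernel => /eqP ->.
  have /asboolP[w_lin _] := valP (repr c').
  exact: linear_fun0.
rewrite -[c]lqpiK res1_class => /(congr1 val)/= z0.
have /asboolP[z_lin zc] := valP (repr c); move: z0 z_lin zc.
set z := val (repr c) => z0 z_lin zc.
have zN (m : kerT pi) : z (val m) = 0 by rewrite /z -res1_fun_pi z0.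
have zE x : z x = z (s (pi x)).
  have := z_lin 1 (val (ker_part x)) (s (pi x)).
  by rewrite zN scaler0 add0r scale1r subrK.
have [||w wE] := @Z1P _ _ _ rho (z \o s).
- by move=> a x y; rewrite /= linearP z_lin.
- move=> x y; rewrite -(zc (s x) (s y)) /ce1 /= /pull_act !sK.
  by rewrite (zE [lie _, _]) lie_morph !sK.
exists (class1 w); rewrite inf1_class; congr (lqpi _ _).
apply/val_inj/funext => x.
by rewrite /= wE /= -zE.
Qed.

Lemma inf1_inj : injective (inf1 pi rho).
Proof.
move=> c c'; rewrite -[c]lqpiK -[c']lqpiK !inf1_class => /lqpiP/asboolP[m zm].
apply/lqpiP/asboolP; exists m; apply/funext => x; have [{}x <-] := pi_surj x.
exact: (congr1 (fun h => h x) zm).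
Qed.

End LowDegree.

(** * Splitting over a free nilpotent algebra *)

(** The extension of g by M that z defines.  As z is a parameter of the type,
    the bracket can be inferred from it. *)
Definition twist (k : fieldType) (g : lieType k) (M : lmodType k)
  (rho : lie_action g M) (z : Z2 rho) : Type := (M * g)%type.

Section TwistedProduct.
Variables (k : fieldType) (g : lieType k) (M : lmodType k).
Variables (rho : lie_action g M) (z : Z2 rho).

Local Notation twist := (twist z).
HB.instance Definition _ := GRing.Lmodule.on twist.

Definition twist_br (u v : twist) : twist :=
  (rho u.2 v.1 - rho v.2 u.1 + val z u.2 v.2, [lie u.2, v.2]).

Let zP : cochain2 (val z) /\ forall x y t, ce2 rho (val z) x y t = 0.
Proof. by have /asboolP := valP z. Qed.
Lemma val_Z2_linl y : linear ((val z)^~ y). Proof. by have [[]] := zP. Qed.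
Lemma val_Z2_linr x : linear (val z x). Proof. by have [[]] := zP. Qed.
Lemma val_Z2_alt x : val z x x = 0. Proof. by have [[]] := zP. Qed.
Lemma val_Z2_closed x y t : ce2 rho (val z) x y t = 0.
Proof. by have [] := zP. Qed.
Lemma val_Z2C x y : val z x y = - val z y x.
Proof.
have := val_Z2_alt (x + y); rewrite (linear_funD (val_Z2_linl _)).
rewrite !(linear_funD (val_Z2_linr _)) !val_Z2_alt add0r addr0.
by move/eqP; rewrite addr_eq0 => /eqP.
Qed.

Fact twist_linearl v : linear (twist_br^~ v).
Proof.
move=> a u u'; rewrite /twist_br; congr (_, _); last exact: lbr_linearl.
rewrite /= act_linearl act_linearr val_Z2_linl !scalerDr scalerN; abel.
Qed.
Fact twist_linearr u : linear (twist_br u).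
Proof.
move=> a v v'; rewrite /twist_br; congr (_, _); last exact: lbr_linearr.
rewrite /= act_linearl act_linearr val_Z2_linr !scalerDr scalerN; abel.
Qed.
Fact twist_brxx u : twist_br u u = 0.
Proof. by rewrite /twist_br subrr add0r val_Z2_alt lbrxx. Qed.
Fact twist_jacobi u v w :
  twist_br u (twist_br v w) + twist_br v (twist_br w u)
  + twist_br w (twist_br u v) = 0.
Proof.
case: u v w => [m x] [m' y] [m'' t]; rewrite /twist_br /=.
congr (_, _); last exact: lbr_jacobi.
rewrite -(val_Z2_closed x y t) /ce2 !act_lie !(actDr, actNr) /=.
rewrite (val_Z2C t x) (lbrC t x) (linear_funN (val_Z2_linr _)).
rewrite !(val_Z2C _ [lie _, _]) !actNr.
by abel.
Qed.
HB.instance Definition _ := Lmodule_isLie.Build k twist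
  twist_linearl twist_linearr twist_brxx twist_jacobi.

Lemma twist_br1 (u v : twist) :
  ([lie u, v] : twist).1 = rho u.2 v.1 - rho v.2 u.1 + val z u.2 v.2.
Proof. by []. Qed.

Lemma snd_linear : linear (@snd M g : twist -> g). Proof. by []. Qed.
Lemma snd_lie : {morph (@snd M g : twist -> g) : u v / [lie u, v]}.
Proof. by []. Qed.
Definition twist_snd : twist -> g := snd.
HB.instance Definition _ :=
  GRing.isLinear.Build k twist g *:%R twist_snd snd_linear.
HB.instance Definition _ := isLieMorphism.Build k twist g twist_snd snd_lie.

(** The bracket of (m, x) with (m', x'), for x' in g^i and m' in M_(r+1-i),
    has three M-components, each in M_(r-i): x m' by definition of the
    filtration, x' m because m is in M_r = M, and z(x, x') because z is in
    F_r. *)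
Lemma twist_lcs r i (u : twist) :
  mfilt rho r =i predT -> filt2 rho r (val z) -> (0 < i)%N ->
  u \in lcs twist i -> u.2 \in lcs g i /\ u.1 \in mfilt rho (r.+1 - i).
Proof.
move=> Mr zr; case: i => // i _; elim: i u => [|i IH] u.
  by rewrite subn1 Mr.
move: u; apply: lcs_ind => // [|a u v [u2 u1] [v2 v1]|u v /IH[v2 v1]].
- by rewrite !rpred0.
- by rewrite !rpredD ?rpredZ.
split; first exact: lcs_br.
rewrite -[_.1]/(rho u.2 v.1 - rho v.2 u.1 + val z u.2 v.2).
have uM : u.1 \in mfilt rho r by rewrite Mr.
rewrite rpredD ?rpredB //.
- by rewrite subnS; apply: mfiltS.
- by rewrite subSS; apply: act_lcs.
- by apply: (zr 1%N i.+1).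
Qed.

End TwistedProduct.

Section LieComp.
Variables (k : fieldType) (L1 L2 L3 : lieType k).
Variables (b : {lie L2 -> L3}) (a : {lie L1 -> L2}).
Fact lie_comp_morph : {morph b \o a : x y / [lie x, y]}.
Proof. by move=> x y; rewrite /= !lie_morph. Qed.
HB.instance Definition _ := isLieMorphism.Build k L1 L3 (b \o a) lie_comp_morph.
End LieComp.

Section FreeNilpotent.
Variables (k : fieldType) (n r : nat) (g : lieType k).
Variable pi : {lie freenil k n r -> g}.
Variables (M : lmodType k) (rho : lie_action g M).
Hypothesis M_nil : mfilt rho r =i predT.

(** Freeness enters here: any lift of pi on the generators extends to a
    morphism Phi into the twisted product, whose M-component is the wanted
    primitive up to sign. *)
Lemma filt2_inf2 (z : Z2 rho) :
  filt2 rho r (val z) -> inf2 pi rho (class2 z) = 0.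
Proof.
move=> zr; rewrite inf2_class; apply/class2_eq0.
pose v i : twist z := (0, pi (freenil_pi k n r (flgen k i))).
pose Phi := fl_lift v.
have Phi2 t : (Phi t).2 = pi (freenil_pi k n r t).
  pose w i := pi (freenil_pi k n r (flgen k i)).
  have e1 : @twist_snd _ _ _ rho z \o Phi =1 fl_lift w.
    by apply: fl_lift_uniq => i; rewrite /= fl_lift_gen.
  have e2 : pi \o freenil_pi k n r =1 fl_lift w by apply: fl_lift_uniq.
  exact: etrans (e1 t) (esym (e2 t)).
pose h (x : freenil k n r) : M := (Phi (repr x)).1.
have hE t : h (freenil_pi k n r t) = (Phi t).1.
  apply/eqP; rewrite -subr_eq0 -[_ - _]/((Phi _ - Phi _).1) -linearB.
  have := repr_lqpi (lcs (freelie k n) r.+1) t => /(lcs_morph (fl_lift v)).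
  by case/(twist_lcs M_nil zr) => // _; rewrite subnn.
have piK (x : freenil k n r) : freenil_pi k n r (repr x) = x by apply: lieqpiK.
exists (fun x => - h x) => [a x y|x y].
  by rewrite -[x]piK -[y]piK -linearP !hE [Phi _]linearP /= scalerN -opprD.
rewrite -[x]piK -[y]piK /ce1 -lie_morph !hE /= /pull_act.
by rewrite [Phi [lie _, _]]lie_morph twist_br1 !Phi2 !actNr; abel.
Qed.

End FreeNilpotent.

(** * The filtration on the image of the connecting map *)

(** Acting on F m amounts to bracketing m, and r+1-l brackets take f^l into
    f^(r+1) = 0. *)
Lemma homg_mfilt (k : fieldType) (f g : lieType k) (pi : {lie f -> g}) r
    (pi_surj : surjective pi) (M : lmodType k) (rho : lie_action g M)
    (F : homg (ker_ab_action pi_surj) rho) l (m : kerT pi) :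
  lcs f r.+1 =i pred1 0 -> (0 < l)%N -> val m \in lcs f l ->
  val F (ker_ab_pi m) \in mfilt rho (r.+1 - l).
Proof.
move=> f_nil; have : (r.+1 <= (r.+1 - l) + l)%N by rewrite addnC -leq_subLR.
move: (r.+1 - l)%N => e; elim: e l m => [|e IH] l m rl l0 ml /=.
  have m0 : m = 0.
    by apply/val_inj/eqP; have := lcs_subset rl ml; rewrite f_nil.
  by rewrite m0 !homgE !linear0 inE.
apply/asboolP => x; have [{}x <-] := pi_surj x.
rewrite -homg_act ker_ab_actionE.
apply: (IH l.+1) => //; first by rewrite addnS.
exact: lcs_br.
Qed.

(** For x in g^i and y in g^j both terms of [s x, s y] - s [x, y] lie in
    f^(i+j). *)
Lemma connecting_FH2 (k : fieldType) (f g : lieType k) (pi : {lie f -> g}) r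
    (pi_surj : surjective pi) (s : {linear g -> f}) (sK : cancel s pi)
    (M : lmodType k) (rho : lie_action g M)
    (F : homg (ker_ab_action pi_surj) rho) :
  lcs f r.+1 =i pred1 0 -> (forall i x, x \in lcs g i -> s x \in lcs f i) ->
  connecting sK F \in FH2 rho r.
Proof.
move=> f_nil sF; apply/asboolP.
exists (push2 F (section_cocycle pi_surj sK)) => // i j x y i0 j0 xi yj.
apply: homg_mfilt => //; first by rewrite addn_gt0 i0.
by apply: rpredB; [apply: lcs_lbr => //; apply: sF|apply/sF/lcs_lbr].
Qed.

(** * Free nilpotent extensions with trivial coefficients *)

(** The kernel lies in the commutator ideal already modulo f^(p+1), and
    f^(p+1) is inside [f, f] as p is positive. *)
Lemma free_extension_ker (k : fieldType) n p r (g : lieType k)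
    (pi : {lie freenil k n r -> g}) :
  (0 < p <= r)%N -> free_nilpotent_extension p pi ->
  {subset lkernel pi <= lcs (freenil k n r) 2}.
Proof.
move=> /andP[p0 pr] [pi0 [_ ker0] piE] x.
have [t <-] : exists t, freenil_pi k n r t = x.
  by exists (repr x); apply: lieqpiK.
rewrite mem_lkernel piE /= [freenil_proj p _]freenil_proj_pi // => /ker0 t2.
have [y|u u2 /lqpiP ut] := lcs_lift (f := freenil_pi k n p) _ t2.
  by exists (repr y); apply: lieqpiK.
have {}t2 : t \in lcs (freelie k n) 2.
  by rewrite -(subKr u t); apply: rpredB => //; apply: lcs_subset ut.
exact: lcs_morph t2.
Qed.

Lemma res1_trivial (k : fieldType) (f g : lieType k) (pi : {lie f -> g})
    (pi_surj : surjective pi) (M : lmodType k) (rho : lie_action g M) c :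
  {subset lkernel pi <= lcs f 2} -> trivial_action rho ->
  res1 pi_surj rho c = 0.
Proof.
move=> ker2 rho0; rewrite -[c]lqpiK res1_class; apply/val_inj/funext => m /=.
rewrite -[m]lqpiK res1_fun_pi; have /asboolP[z_lin zc] := valP (repr c).
have := ker2 _ (valP (repr m)); move: (val (repr m)) => x.
move: x; apply: lcs_ind => // [|a x y zx zy|a b _].
- exact: linear_fun0.
- by rewrite z_lin zx zy scaler0 addr0.
have /eqP := zc a b; rewrite /ce1 /= /pull_act !rho0 subrr sub0r oppr_eq0.
by move/eqP.
Qed.

Theorem theorem1p5 (k : fieldType) (g : finLieType k) (M : vectType k)
  (rho : lie_action g M) (p q r n : nat)
  (g_nilp : nilpotent_step g p)
  (M_nilp : nilpotent_action rho q)
  (g_gens : has_dim (lquot (lcs g 2)) n)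
  (r_ge : (maxn p q <= r)%N) (r_le : (r <= p + q)%N)
  (pi : {lie freenil k n r -> g})
  (pi_surj : surjective pi)
  (pi_ext : free_nilpotent_extension p pi) :
  FH2 rho r =i lkernel (inf2 pi rho) /\
  exists d : {linear homg (ker_ab_action pi_surj) rho -> subm (FH2 rho r)},
    [/\ forall phi : Z2 (ker_ab_action pi_surj),
          corresponding_cocycle (ker_ab_incl pi) (ext_ab_proj pi) phi ->
          forall f, val (d f) = class2 (push2 f phi),
        [/\ injective (inf1 pi rho),
            exact_at (inf1 pi rho) (res1 pi_surj rho),
            exact_at (res1 pi_surj rho) d
          & surjective d]
      & trivial_action rho -> bijective d].
Proof.
move: r_ge; rewrite geq_max => /andP[pr qr].
have [p0 _ g_nil] := g_nilp; have [_ _ M_nil] := M_nilp.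
have f_nil : lcs (freenil k n r) r.+1 =i pred1 0.
  move=> x; apply/idP/idP => [/freenil_lcs0 ->|]; first by rewrite inE.
  by rewrite inE => /eqP ->; apply: rpred0.
have M_nil' : mfilt rho r =i predT.
  move=> m; apply: mfilt_subset qr _ _; by rewrite M_nil.
have [s sK sF] := filtered_section pi_surj g_nil.
pose D (F : homg (ker_ab_action pi_surj) rho) := connecting sK F.
have FH2E : FH2 rho r =i lkernel (inf2 pi rho).
  move=> c; rewrite mem_lkernel; apply/idP/eqP => [/asboolP[z zr <-]|].
    exact: filt2_inf2.
  by move=> /(ker_inf2 pi_surj sK)[F <-]; apply: connecting_FH2.
split=> //.
have D_FH2 F : D F \in FH2 rho r by apply: connecting_FH2.
pose d F : subm (FH2 rho r) := subm_in (D_FH2 F).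
have d_lin : linear d.
  by move=> a F G; apply/val_inj; exact: connecting_linear.
pose dl : {linear homg (ker_ab_action pi_surj) rho -> subm (FH2 rho r)} :=
  HB.pack d (GRing.isLinear.Build k _ _ *:%R d d_lin).
have d0 F : dl F = 0 <-> D F = 0.
  split=> [/(congr1 val)//|DF]; exact/val_inj.
have d_surj : surjective dl.
  move=> c; have : val c \in lkernel (inf2 pi rho).
    by rewrite -FH2E; apply: valP.
  rewrite mem_lkernel => /eqP/(ker_inf2 pi_surj sK)[F DF].
  by exists F; apply/val_inj.
exists dl; split.
- move=> phi phi_corr F; apply/esym/class2_push2.
  exact: corresponding_class.
- split=> //; first exact: inf1_inj.
  + by move=> c; apply: ker_res1.
  + by move=> F; rewrite d0; apply: ker_connecting.
move=> rho0.
have d_inj : injective dl.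
  move=> F G FG; apply/eqP; rewrite -subr_eq0.
  have : dl (F - G) = 0 by rewrite linearB FG subrr.
  rewrite d0 => /ker_connecting[c <-]; apply/eqP/res1_trivial => //.
  by apply: free_extension_ker pi_ext; rewrite p0.
have [e eK] := choice d_surj.
by exists e => // F; apply: d_inj; rewrite eK.
Qed.
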